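(* Let $\omega>0$ and $0<\mu<2\sqrt{\omega}$. Then the equation $$\phi_{xxxx}+\mu\phi_{xx}+\omega\phi-\phi^3=0,\qquad x\in\mathbb{R},$$ has a nontrivial real-valued classical solution $\phi$, with $\phi\in H^\infty(\mathbb{R})=\bigcap_{j\ge0}H^j(\mathbb{R})$ and exponential decay: there is a constant $C$ such that $$|\phi(x)|\le C\,e^{-\frac{\sqrt{2\sqrt{\omega}-\mu}}{2}|x|},\qquad x\in\mathbb{R}.$$
   Context: The equation is the profile equation for solitary waves $u(t,x)=e^{-i\omega t}\phi(x)$ of the fourth-order nonlinear Schrödinger equation $iu_t+u_{xxxx}+\mu u_{xx}-|u|^2u=0$, where $\mu>0$ and $\omega>0$. *)

(* Defs.v *)
From HB Require Import structures.
From mathcomp Require Import all_boot all_order all_algebra.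
From mathcomp Require Import all_classical all_reals all_analysis.

Set Implicit Arguments.
Unset Strict Implicit.
Unset Printing Implicit Defensive.
Import Order.TTheory GRing.Theory Num.Theory.
Import numFieldNormedType.Exports.

Local Open Scope classical_set_scope.
Local Open Scope ring_scope.

(* derive1n is total; it yields a meaningful derivative only under the explicit
   derivability requirements below. *)
Definition Ck (R : realType) (n : nat) (f : R -> R) : Prop :=
  (forall k, (k < n)%N -> forall x, derivable (derive1n k f) x 1) /\
  (forall k, (k <= n)%N -> continuous (derive1n k f)).

Definition test_function (R : realType) (psi : R -> R) : Prop :=
  (forall n, Ck n psi) /\ compact (closure [set x | psi x != 0]).

(* g is the k-th weak derivative of f.  Only used for f and g in L^2, for which
   both integrands are integrable. *)
Definition weak_derivative (R : realType) (k : nat) (f g : R -> R) : Prop :=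
  forall psi : R -> R, test_function psi ->
    \int[@lebesgue_measure R]_x (f x * derive1n k psi x) =
    (-1) ^+ k * \int[@lebesgue_measure R]_x (g x * psi x).

(* Case k = 0 gives f itself in L^2, up to a null set; it is also required
   directly, so that f is measurable. *)
Definition Sobolev (R : realType) (j : nat) (f : R -> R) : Prop :=
  f \in Lfun (@lebesgue_measure R) 2%:E /\
  forall k, (k <= j)%N -> exists g : R -> R,
    g \in Lfun (@lebesgue_measure R) 2%:E /\ weak_derivative k f g.

Definition Sobolev_infty (R : realType) (f : R -> R) : Prop :=
  forall j, Sobolev j f.

Definition classical_solution (R : realType) (omega mu : R) (phi : R -> R) :
    Prop :=
  Ck 4 phi /\
  forall x, derive1n 4 phi x + mu * derive1n 2 phi x + omega * phi x - phi x ^+ 3 = 0.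

(* Main.v *)
Require Import Defs.
From HB Require Import structures.
From mathcomp Require Import all_boot all_order all_algebra.
From mathcomp Require Import all_classical all_reals all_analysis.
From mathcomp Require Import measurable_realfun.
From mathcomp Require Import zify ring lra.
Import Order.TTheory GRing.Theory Num.Theory.
Import numFieldNormedType.Exports.
Local Open Scope classical_set_scope.
Local Open Scope ring_scope.
Set Implicit Arguments.
Unset Strict Implicit.
Unset Printing Implicit Defensive.


(** Write the linear part as the symbol D^4 + mu D^2 + omega.  Since mu < 2 sqrt omega its
    roots are the four numbers +-a +- ib with a = sqrt (2 sqrt omega - mu) / 2 and
    b = sqrt (2 sqrt omega + mu) / 2, and the form s^2 + mu t s + omega t^2 is positive
    definite ([coercive_symbol]).  Up to scaling, a solitary wave is found as a maximiser of
    the integral of u^4 among functions of unit energy, the energy being the integral of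
    u''^2 + mu u u'' + omega u^2.  On the whole line the existence of a maximiser is a matter
    of concentration compactness; here it is obtained by a double approximation, of the line
    by a long cycle and of the cycle by a lattice.

    On a cycle of N points with mesh h, with the centred second difference in place of D^2,
    the energy is coercive by the pointwise inequality above, the maximisation is a finite
    dimensional compact problem ([maximizer_exists]), and a rescaled maximiser solves the
    difference equation Lap^2 u + mu Lap u + omega u = u^3 ([critical_point_exists]).
    Comparison with one fixed bump bounds its energy, uniformly in h and N
    ([bump_energy_le], [bump_quartic_ge]).  The discrete Sobolev inequality
    ([lattice_sobolev]) and the equation turn this into uniform bounds on u and its
    differences up to order five ([critical_bounds], [critical_higher_bounds]).  Since a
    critical point has equal energy and quartic integral, its maximum stays away from 0
    ([critical_peak]), and by translation invariance of the cycle the peak may be put at the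
    origin.  This is all that is required to prevent the limit from being trivial.

    Now h tends to 0 and h N to infinity.  Limits along a non-principal ultrafilter exist for
    all bounded sequences at once and respect products and inequalities.  Taylor's formula of
    first order with quadratic remainder is such an inequality, so the limits of u and of its
    differences are successive derivatives of one another ([limit_is_derive]), without any
    uniform convergence.  The partial sums of h u^2 give in the same way a bounded primitive
    of phi^2.  Hence phi is a nonzero bounded solution on the line ([bounded_profile_exists])
    and, being Lipschitz, it tends to 0 at infinity ([vanishing_of_integrable]).

    For the decay, factor the symbol as ((D - a)^2 + b^2) ((D + a)^2 + b^2).  The function
    ((D + a)^2 + b^2) phi solves the unstable factor, and phi itself the stable one with that
    function as a source; let W and V be the corresponding squared norms.  The linear flow
    multiplies W by exp (2 a x) and, where W vanishes, V by exp (-2 a x).  As the solution is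
    bounded and phi is small, W remains below a small multiple of V; this forces a first
    exponential rate.  The cubic term then decays faster than the linear flow, which improves
    the rate to the sharp one ([half_line_decay]).  The reflection of x gives the other end.

    Finally the functions obtained from phi, phi', phi'', phi''' by sums and products are
    closed under differentiation, because of the equation, and each is bounded by a multiple
    of exp (- a |x|).  So all derivatives of phi are square integrable, and integration by
    parts identifies them with its weak derivatives ([decay_class_Sobolev]). *)


(** * Calculus on a periodic lattice *)

Section Lattice.
Variables (R : realType) (n : nat) (h : R).
Hypothesis h_gt0 : 0 < h.
Implicit Types u v : 'I_n.+2 -> R.

(** The Riemann sum that stands for the integral over one period. *)
Definition lattice_sum u : R := h * \sum_i u i.
Definition forward_diff u i : R := (u (i + 1) - u i) / h.
Definition lattice_lap u i : R := (u (i + 1) - 2 * u i + u (i - 1)) / h ^+ 2.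

Let h_neq0 : h != 0. Proof. by rewrite gt_eqF. Qed.

Lemma lattice_sum_shift a u : lattice_sum (fun i => u (i + a)) = lattice_sum u.
Proof. by rewrite /lattice_sum [in RHS](reindex_inj (addIr a)). Qed.

Lemma lattice_sumD u v : lattice_sum (fun i => u i + v i) = lattice_sum u + lattice_sum v.
Proof. by rewrite /lattice_sum big_split mulrDr. Qed.

Lemma lattice_sumZ (k : R) u : lattice_sum (fun i => k * u i) = k * lattice_sum u.
Proof. by rewrite /lattice_sum -mulr_sumr mulrCA. Qed.

Lemma eq_lattice_sum u v : u =1 v -> lattice_sum u = lattice_sum v.
Proof. by move=> /funext ->. Qed.

Lemma le_lattice_sum u v : (forall i, u i <= v i) -> lattice_sum u <= lattice_sum v.
Proof. by move=> uv; rewrite ler_pM2l// ler_sum. Qed.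

Lemma lattice_sum_ge0 u : (forall i, 0 <= u i) -> 0 <= lattice_sum u.
Proof. by move=> u0; rewrite mulr_ge0 ?(ltW h_gt0)// sumr_ge0. Qed.

Lemma lattice_sum_lap_sym u v :
  lattice_sum (fun i => lattice_lap u i * v i) = lattice_sum (fun i => u i * lattice_lap v i).
Proof.
have E w z : lattice_sum (fun i => lattice_lap w i * z i) = h ^- 2 *
    (lattice_sum (fun i => w (i + 1) * z i) + (- 2) * lattice_sum (fun i => w i * z i)
     + lattice_sum (fun i => w (i - 1) * z i)).
  rewrite -lattice_sumZ -!lattice_sumD -lattice_sumZ; apply: eq_lattice_sum => i;
      rewrite /lattice_lap; field.
  exact: h_neq0.
have E1 w z : lattice_sum (fun i => w (i + 1) * z i) = lattice_sum (fun i => w i * z (i - 1)).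
  by rewrite -(lattice_sum_shift 1 (fun i => w i * z (i - 1))); apply: eq_lattice_sum => i;
      rewrite addrK.
rewrite (eq_lattice_sum (u := fun i => u i * lattice_lap v i) (v := fun i => lattice_lap v i * u
    i));
  last by move=> i; rewrite mulrC.
rewrite (E u v) (E v u) (E1 u v) (E1 v u); congr (_ * _).
have C w z : lattice_sum (fun i => w i * z i) = lattice_sum (fun i => z i * w i).
  by apply: eq_lattice_sum => i; rewrite mulrC.
rewrite (C u (fun i => v (i - 1))) (C v (fun i => u (i - 1))) (C v u).
ring.
Qed.

(** Summation by parts, for the integral of u'^2 = - the integral of u u''. *)
Lemma lattice_sum_fwd_sq u :
  lattice_sum (fun i => forward_diff u i ^+ 2) = - lattice_sum (fun i => u i * lattice_lap u i).
Proof.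
have -> : lattice_sum (fun i => forward_diff u i ^+ 2) = h ^- 2 *
    (lattice_sum (fun i => u (i + 1) ^+ 2) + (- 2) * lattice_sum (fun i => u (i + 1) * u i)
     + lattice_sum (fun i => u i ^+ 2)).
  rewrite -lattice_sumZ -!lattice_sumD -lattice_sumZ; apply: eq_lattice_sum => i;
      rewrite /forward_diff; field.
  exact: h_neq0.
have -> : lattice_sum (fun i => u i * lattice_lap u i) = h ^- 2 *
    (lattice_sum (fun i => u (i + 1) * u i) + (- 2) * lattice_sum (fun i => u i ^+ 2)
     + lattice_sum (fun i => u (i - 1) * u i)).
  rewrite -lattice_sumZ -!lattice_sumD -lattice_sumZ; apply: eq_lattice_sum => i;
      rewrite /lattice_lap; field.
  exact: h_neq0.
rewrite (lattice_sum_shift 1 (fun i => u i ^+ 2)).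
rewrite -(lattice_sum_shift 1 (fun i => u (i - 1) * u i)).
rewrite (eq_lattice_sum (u := fun i => u (i + 1 - 1) * u (i + 1)) (v := fun i => u (i + 1) * u i)).
  ring.
by move=> i; rewrite addrK mulrC.
Qed.

(** The points i, i + 1, ..., i + n + 1 exhaust the cycle, whatever the starting point. *)
Lemma sum_along_cycle (g : 'I_n.+2 -> R) i :
  \sum_(l < n.+2) g (i + (l : nat)%:R) = \sum_k g k.
Proof.
rewrite [in RHS](reindex_inj (addrI i)); apply: eq_bigr => l _.
by congr (g (i + _)); exact: (natr_Zp (l : 'Z_(n.+2))).
Qed.

(** The variation of u^2 along a path is at most the sum of h |Du| |u(k) + u(k+1)|, which the
    two hypotheses bound by 3 A.  Averaging over the end point of the path then bounds u(i)^2 by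
    3 A plus the mean of u^2, and the mean is at most A because the period is at least 1. *)
Lemma lattice_sobolev (A : R) u : 1 <= h * n.+2%:R ->
  lattice_sum (fun i => u i ^+ 2) <= A -> lattice_sum (fun i => forward_diff u i ^+ 2) <= A ->
  forall i, u i ^+ 2 <= 4 * A.
Proof.
move=> L1 uA duA i.
have A0 : 0 <= A by apply: le_trans uA; apply: lattice_sum_ge0 => k; exact: sqr_ge0.
pose g k := `|u (k + 1) ^+ 2 - u k ^+ 2|.
have gA : \sum_k g k <= 3 * A.
  have gle k : g k <= h * (forward_diff u k ^+ 2 + (u (k + 1) ^+ 2 + u k ^+ 2)).
    have -> : g k = h * `|forward_diff u k * (u (k + 1) + u k)|.
      rewrite -{1}(gtr0_norm h_gt0) -normrM; congr `|_|; rewrite /forward_diff; field.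
      exact: h_neq0.
    rewrite ler_pM2l// ler_norml.
    have := sqr_ge0 (forward_diff u k + (u (k + 1) + u k)).
    have := sqr_ge0 (forward_diff u k - (u (k + 1) + u k)).
    have := sqr_ge0 (u (k + 1) - u k).
    move=> a1 a2 a3; apply/andP; split; nra.
  have : \sum_k g k <= lattice_sum (fun k => forward_diff u k ^+ 2 + (u (k + 1) ^+ 2 + u k ^+ 2)).
    by rewrite /lattice_sum mulr_sumr; apply: ler_sum.
  rewrite lattice_sumD lattice_sumD (lattice_sum_shift 1 (fun k => u k ^+ 2)); lra.
have step j : (j <= n.+2)%N -> u i ^+ 2 <= u (i + j%:R) ^+ 2 + \sum_(l < j) g (i + (l : nat)%:R).
  elim: j => [|j IH] jn; first by rewrite big_ord0 !addr0.
  apply: (le_trans (IH (ltnW jn))); rewrite big_ord_recr/=.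
  rewrite [in X in _ <= X]addrCA -[X in X <= _]addrC lerD2l /g.
  rewrite -natr1 addrA.
  set a := u (i + j%:R) ^+ 2; set b := u _ ^+ 2.
  have := ler_norm (a - b); rewrite distrC; lra.
have all_k k : u i ^+ 2 <= u k ^+ 2 + 3 * A.
  pose j : 'I_n.+2 := k - i.
  have := step j (ltnW (ltn_ord j)).
  rewrite (_ : i + (j : nat)%:R = k); last first.
    by rewrite (natr_Zp (j : 'Z_(n.+2))) /j addrC subrK.
  move=> /le_trans; apply; rewrite lerD2l; apply: le_trans gA.
  rewrite -(sum_along_cycle g i).
  rewrite (big_ord_widen _ (fun l => g (i + l%:R)) (ltnW (ltn_ord j))).
  by rewrite [leRHS](bigID (fun l : 'I_n.+2 => (l < j)%N))/= lerDl sumr_ge0// => l _;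
      exact: normr_ge0.
have H : lattice_sum (fun=> u i ^+ 2) <= lattice_sum (fun k => u k ^+ 2 + 3 * A) by exact:
    le_lattice_sum.
have cstE (k : R) : lattice_sum (fun=> k) = k * (h * n.+2%:R).
  by rewrite /lattice_sum sumr_const card_ord -[k *+ _]mulr_natr mulrCA.
move: H; rewrite lattice_sumD !cstE => H.
have LA : A <= A * (h * n.+2%:R) by rewrite ler_peMr.
rewrite -subr_ge0 -(@pmulr_lge0 _ (h * n.+2%:R)) ?(lt_le_trans _ L1)//.
move: (h * n.+2%:R) H LA => L H LA; lra.
Qed.

End Lattice.

(** * The lattice variational problem *)

(** First order condition at an extremum, in the form that suits a polynomial deviation: a
    linear term dominated by a quadratic one near 0 vanishes. *)
Lemma linear_le_square_eq0 (R : realFieldType) (a M : R) :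
  (forall t, `|t| <= 1 -> a * t <= M * t ^+ 2) -> a = 0.
Proof.
move=> H; apply/eqP; apply: contraT => a0.
pose K := `|a| + `|M| + 1.
have K0 : 0 < K by rewrite /K; have := normr_ge0 a; have := normr_ge0 M; lra.
have t1 : `|a / K| <= 1.
  rewrite normrM normfV (gtr0_norm K0) ler_pdivrMr// mul1r /K.
  by have := normr_ge0 M; lra.
have := H _ t1; rewrite expr_div_n mulrA -expr2 mulrA.
rewrite ler_pdivlMr ?exprn_gt0// [X in X <= _](_ : _ = K * a ^+ 2); last first.
  by field; rewrite gt_eqF.
have a2 : 0 < a ^+ 2 by rewrite lt_neqAle eq_sym sqrf_eq0 a0 sqr_ge0.
rewrite ler_pM2r// leNgt => /negP; case.
rewrite /K; have := ler_norm M; have := normr_ge0 a; lra.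
Qed.

(** The hypothesis [coercive] is the positivity of the Fourier symbol, read as a quadratic form
    in (u'', u). *)
Section Variational.
Variables (R : realType) (n : nat) (h mu omega c : R).
Hypotheses (h_gt0 : 0 < h) (c_gt0 : 0 < c).
Hypothesis coercive : forall s t : R,
  c * (s ^+ 2 + t ^+ 2) <= s ^+ 2 + mu * (t * s) + omega * t ^+ 2.
Implicit Types u v w : 'I_n.+2 -> R.

Local Notation isum := (@lattice_sum R n h).
Local Notation lap := (@lattice_lap R n h).

(** The mixed term u Lap u is used instead of - (D u)^2, which has the same sum.  With it the
    density itself is positive, so that coercivity holds without summation by parts. *)
Definition lattice_energy u :=
  isum (fun i => lap u i ^+ 2 + mu * (u i * lap u i) + omega * u i ^+ 2).
Definition lattice_quartic u := isum (fun i => u i ^+ 4).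
(** Half the gradient of the energy. *)
Definition lattice_euler u i := lap (lap u) i + mu * lap u i + omega * u i.

Local Notation energy := lattice_energy.
Local Notation quartic := lattice_quartic.
Local Notation euler := lattice_euler.

Lemma lap_linear u w t i : lap (fun i => u i + t * w i) i = lap u i + t * lap w i.
Proof. by rewrite /lattice_lap; field; rewrite gt_eqF. Qed.

Lemma energy_coercive u : c * (isum (fun i => lap u i ^+ 2) + isum (fun i => u i ^+ 2)) <= energy u.
Proof. by rewrite -lattice_sumD -lattice_sumZ; apply: le_lattice_sum => // i; exact: coercive. Qed.

Lemma energyD u w t : energy (fun i => u i + t * w i) =
  energy u + 2 * t * isum (fun i => w i * euler u i) + t ^+ 2 * energy w.
Proof.
have -> : isum (fun i => w i * euler u i) =
    isum (fun i => lap u i * lap w i) + mu / 2 * isum (fun i => lap u i * w i)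
    + mu / 2 * isum (fun i => u i * lap w i) + omega * isum (fun i => u i * w i).
  rewrite -(lattice_sum_lap_sym h_gt0 (lap u) w) -(lattice_sum_lap_sym h_gt0 u w).
  rewrite -!lattice_sumZ -!lattice_sumD; apply: eq_lattice_sum => i; rewrite /lattice_euler;
      by field.
rewrite /lattice_energy -!lattice_sumZ -!lattice_sumD -lattice_sumZ -!lattice_sumD;
    apply: eq_lattice_sum => i.
by rewrite lap_linear; field.
Qed.

Lemma energyZ w t : energy (fun i => t * w i) = t ^+ 2 * energy w.
Proof.
rewrite /lattice_energy -lattice_sumZ; apply: eq_lattice_sum => i.
have -> : lap (fun i => t * w i) i = t * lap w i by rewrite /lattice_lap; field; rewrite gt_eqF.
ring.
Qed.

Lemma quarticZ w t : quartic (fun i => t * w i) = t ^+ 4 * quartic w.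
Proof. by rewrite /lattice_quartic -lattice_sumZ; apply: eq_lattice_sum => i; ring. Qed.

Lemma continuous_lattice_sum (T : topologicalType) (f : T -> 'I_n.+2 -> R) :
  (forall i, continuous (f ^~ i)) -> continuous (fun x => isum (f x)).
Proof.
move=> fc x; rewrite /lattice_sum; apply: cvgM; first exact: cvg_cst.
by apply: cvg_big => [|i _]; [exact: add_continuous|exact: fc].
Qed.

Lemma continuous_pow (T : topologicalType) k (f : T -> R) :
  continuous f -> continuous (fun x => f x ^+ k).
Proof.
move=> fc x; have := @continuous_comp _ _ _ f (fun y => y ^+ k) x (fc x).
by apply; exact: exprn_continuous.
Qed.

Lemma continuous_energy (T : topologicalType) (f : T -> 'I_n.+2 -> R) :
  (forall i, continuous (f ^~ i)) -> continuous (fun x => energy (f x)).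
Proof.
move=> fc.
have lapc i : continuous (fun x => lap (f x) i).
  move=> x; rewrite /lattice_lap; apply: cvgM; last exact: cvg_cst.
  apply: cvgD; last exact: fc.
  apply: cvgB; first exact: fc.
  by apply: cvgM; [exact: cvg_cst|exact: fc].
apply: continuous_lattice_sum => i x; apply: cvgD; last first.
  by apply: cvgM; [exact: cvg_cst|exact: (@continuous_pow T 2 (f ^~ i) (fc i) x)].
apply: cvgD; first exact: (@continuous_pow T 2 _ (lapc i) x).
apply: cvgM; first exact: cvg_cst.
by apply: cvgM; [exact: fc|exact: lapc].
Qed.

Lemma continuous_quartic (T : topologicalType) (f : T -> 'I_n.+2 -> R) :
  (forall i, continuous (f ^~ i)) -> continuous (fun x => quartic (f x)).
Proof.
by move=> fc; apply: continuous_lattice_sum => i; exact: (@continuous_pow T 4 (f ^~ i) (fc i)).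
Qed.

Let crd (x : 'rV[R]_n.+2) (i : 'I_n.+2) : R := x 0 i.

Let crd_cont i : continuous (crd ^~ i). Proof. exact: coord_continuous. Qed.

(** Coercivity bounds every coordinate on the unit energy level, which is therefore compact in
    a finite dimensional space. *)
Lemma maximizer_exists :
  exists u, energy u = 1 /\ forall v, energy v = 1 -> quartic v <= quartic u.
Proof.
pose A := [set x : 'rV[R]_n.+2 | energy (crd x) = 1].
have Ec : continuous (fun x => energy (crd x)) by exact: continuous_energy.
have Qc : continuous (fun x => quartic (crd x)) by exact: continuous_quartic.
have A0 : A !=set0.
  pose one : 'I_n.+2 -> R := fun=> 1.
  have e0 : 0 < energy one.
    apply: lt_le_trans (energy_coercive _); rewrite mulr_gt0//.
    rewrite ltr_wpDl//; first by apply: lattice_sum_ge0 => // i; exact: sqr_ge0.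
    rewrite /lattice_sum mulr_gt0// /one sumr_const card_ord expr1n pmulrn_lgt0//.
  exists (\row_i ((Num.sqrt (energy one))^-1 * one i)).
  rewrite /A /=; rewrite (_ : crd _ = fun i => (Num.sqrt (energy one))^-1 * one i); last first.
    by apply/funext => i; rewrite /crd mxE.
  by rewrite energyZ exprVn sqr_sqrtr ?(ltW e0)// mulVf// gt_eqF.
have Acl : closed A.
  rewrite (_ : A = (fun x => energy (crd x)) @^-1` [set 1]); last by apply/seteqP; split.
  apply: preimage_closed => //; exact: closed_eq.
have Abd : bounded_set A.
  exists (1 + (c * h)^-1); split; first exact: num_real.
  move=> M ltM x Ax; apply: le_trans (ltW ltM); rewrite /Num.Def.normr/= mx_normrE.
  have xi i : `|x 0 i| <= 1 + (c * h)^-1.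
    have xi2 : x 0 i ^+ 2 <= (c * h)^-1.
      rewrite -[leRHS]mul1r ler_pdivlMr ?mulr_gt0// mulrC.
      rewrite -{1}Ax; apply: le_trans (energy_coercive _); rewrite -mulrA ler_pM2l//.
      rewrite ler_wpDl//; first by apply: lattice_sum_ge0 => // j; exact: sqr_ge0.
      rewrite /lattice_sum ler_pM2l// (bigD1 i)//= lerDl sumr_ge0// => j _; exact: sqr_ge0.
    rewrite -real_normK ?num_real// in xi2.
    have := sqr_ge0 (`|x 0 i| - 1); have := normr_ge0 (x 0 i).
    move: xi2; move: `|x 0 i| (c * h)^-1 => y z; nra.
  apply/bigmax_leP; split; first by rewrite addr_ge0// invr_ge0 mulr_ge0// ltW.
  by move=> [j i] _ /=; rewrite (ord1 j).
have Acpt := bounded_closed_compact Abd Acl.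
have [x xA xmax] := compact_EVT_max A0 Acpt (continuous_subspaceT Qc).
exists (crd x); split; first by rewrite inE in xA.
move=> v v1; have := xmax (\row_i v i).
rewrite (_ : crd (\row_i v i) = v); last by apply/funext => i; rewrite /crd mxE.
apply; rewrite inE /A/=.
by rewrite (_ : crd (\row_i v i) = v)//; apply/funext => i; rewrite /crd mxE.
Qed.

(** Homogeneity, of degree 4 for the quartic and 2 for the energy, removes the constraint. *)
Lemma quartic_le_energy u : energy u = 1 ->
  (forall v, energy v = 1 -> quartic v <= quartic u) ->
  forall v, quartic v <= quartic u * energy v ^+ 2.
Proof.
move=> u1 umax v.
have sq_ge0 w : 0 <= isum (fun i => w i ^+ 2) by apply: lattice_sum_ge0 => // i; exact: sqr_ge0.
have := energy_coercive v; have := sq_ge0 v; have := sq_ge0 (lap v).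
have [e0|e0|->] := ltgtP (energy v) 0; last first.
- move=> lv0 v0; rewrite expr0n mulr0 pmulr_rle0// => vle.
  have {vle} v0' : isum (fun i => v i ^+ 2) = 0 by apply/eqP; rewrite eq_le v0 andbT; lra.
  rewrite /lattice_quartic (_ : (fun i => v i ^+ 4) = fun=> 0).
    by rewrite /lattice_sum big1// mulr0.
  apply/funext => i; have := v0'; rewrite /lattice_sum => /eqP.
  rewrite mulf_eq0 gt_eqF//= psumr_eq0 => [|j _]; last exact: sqr_ge0.
  by move=> /allP/(_ i); rewrite mem_index_enum/= sqrf_eq0 => /(_ isT)/eqP ->; rewrite expr0n.
- move=> _ _ _; have := umax (fun i => (Num.sqrt (energy v))^-1 * v i).
  rewrite energyZ quarticZ -[4%N]/(2 * 2)%N exprM !exprVn sqr_sqrtr ?(ltW e0)//.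
  by rewrite mulVf ?gt_eqF// => /(_ erefl); rewrite mulrC ler_pdivrMr// exprn_gt0.
- by move=> lv0 v0 cle; have := le_trans (mulr_ge0 (ltW c_gt0) (addr_ge0 lv0 v0)) cle;
    rewrite leNgt e0.
Qed.

(** By convexity of the fourth power, (x + y)^4 >= x^4 + 4 x^3 y, the perturbed quartic is
    bounded below by its linearisation, so only the energy has to be expanded in t. *)
Lemma euler_lagrange u : energy u = 1 ->
  (forall v, energy v = 1 -> quartic v <= quartic u) ->
  forall j, quartic u * euler u j = u j ^+ 3.
Proof.
move=> u1 umax j; have H := quartic_le_energy u1 umax.
(* The test direction is the unit vector at j. *)
pose w (i : 'I_n.+2) : R := (i == j)%:R.
have lattice_sum_w f : isum (fun i => w i * f i) = h * f j.
  rewrite /lattice_sum (bigD1 j)//= /w eqxx mul1r big1 ?addr0// => i /negPf ->.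
  by rewrite mul0r.
have S0 : 0 <= quartic u.
  by apply: lattice_sum_ge0 => // i; rewrite -[4%N]/(2 * 2)%N exprM sqr_ge0.
have qD t : quartic u + 4 * t * isum (fun i => w i * u i ^+ 3) <= quartic (fun i => u i + t * w i).
  rewrite /lattice_quartic -lattice_sumZ -lattice_sumD; apply: le_lattice_sum => // i.
  rewrite -subr_ge0.
  rewrite [leRHS](_ : _ = (t * w i) ^+ 2 * (2 * u i ^+ 2 + (2 * u i + t * w i) ^+ 2)); last by ring.
  by rewrite mulr_ge0 ?sqr_ge0// addr_ge0 ?sqr_ge0// mulr_ge0 ?sqr_ge0.
set b := h * euler u j; set g := h * u j ^+ 3; set e := energy w.
have lin t : `|t| <= 1 ->
    (4 * (g - quartic u * b)) * t <=
    (quartic u * (4 * b ^+ 2 + 4 * `|b| * `|e| + 2 * `|e| + e ^+ 2)) * t ^+ 2.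
  move=> t1; have := le_trans (qD t) (H _); rewrite energyD !lattice_sum_w u1 -/b -/g -/e.
  set S := quartic u in S0 *.
  have t2 : `|t ^+ 2| <= 1 by rewrite normrX exprn_ile1.
  have te : `|4 * t * b * e| <= 4 * `|b| * `|e|.
    rewrite !normrM (ger0_norm (ler0n _ _)) -!mulrA ler_pM2l//.
    by rewrite ler_piMl ?mulr_ge0.
  have tee : t ^+ 2 * e ^+ 2 <= e ^+ 2.
    by rewrite ler_piMl ?sqr_ge0//; exact: le_trans (ler_norm _) t2.
  have := ler_norm (4 * t * b * e); have := ler_norm e.
  move=> e1 e2; rewrite [X in _ <= X](_ : _ =
    S * (1 + 4 * t * b + t ^+ 2 * (4 * b ^+ 2 + 4 * t * b * e + 2 * e + t ^+ 2 * e ^+ 2)));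
        last by ring.
  rewrite [X in _ -> _ <= X](_ : _ = S * (t ^+ 2 * (4 * b ^+ 2 + 4 * `|b| * `|e| + 2 * `|e| + e
      ^+ 2))); last by ring.
  set X := (X in 1 + _ + _ * X); set Y := (X in _ -> _ <= S * (_ * X)).
  have XY : X <= Y by rewrite /X /Y; lra.
  have : S * (t ^+ 2 * X) <= S * (t ^+ 2 * Y) by rewrite ler_wpM2l// ler_wpM2l// sqr_ge0.
  move: (t ^+ 2 * X) (t ^+ 2 * Y) => X' Y'; lra.
have /eqP := linear_le_square_eq0 lin.
rewrite mulf_eq0 pnatr_eq0/= subr_eq0 /g /b => /eqP/esym.
by rewrite mulrCA; apply: mulfI; rewrite gt_eqF.
Qed.

(** Dividing a maximiser by the square root of the maximum S turns S Lu = u^3 into Lu = u^3, and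
    gives it energy 1 / S.  The competitor v serves to bound 1 / S. *)
Lemma critical_point_exists K v : 0 < quartic v -> energy v ^+ 2 <= K * quartic v ->
  exists u, [/\ forall j, euler u j = u j ^+ 3, energy u = quartic u,
    0 < quartic u & quartic u <= K].
Proof.
move=> v0 vK; have [u [u1 umax]] := maximizer_exists.
have H := quartic_le_energy u1 umax v.
have S0 : 0 < quartic u.
  have := lt_le_trans v0 H; have := sqr_ge0 (energy v); move: (quartic u) (_ ^+ 2) => s e e0 se.
  by rewrite ltNge; apply/negP => s0; have := mulr_ge0_le0 e0 s0; rewrite mulrC; lra.
pose k := (Num.sqrt (quartic u))^-1.
have k2 : k ^+ 2 = (quartic u)^-1 by rewrite exprVn sqr_sqrtr// ltW.
have q : quartic (fun i => k * u i) = (quartic u)^-1.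
  rewrite quarticZ -[4%N]/(2 * 2)%N exprM k2; field; exact: lt0r_neq0.
exists (fun i => k * u i); rewrite q; split.
- move=> j; have -> : euler (fun i => k * u i) j = k * euler u j.
    by rewrite /lattice_euler /lattice_lap; field; rewrite gt_eqF.
  have := euler_lagrange u1 umax j => /(congr1 ( *%R (k * k ^+ 2))).
  rewrite exprMn [in RHS]exprS => <-; rewrite k2; field; exact: lt0r_neq0.
- by rewrite energyZ u1 k2 mulr1.
- by rewrite invr_gt0.
- rewrite -[_^-1]mul1r ler_pdivrMr//.
  rewrite -(ler_pM2r v0) mul1r (mulrC K) -mulrA.
  by apply: le_trans H _; rewrite ler_pM2l.
Qed.
End Variational.

(** * Bounds independent of the mesh and of the period *)

(** None of the constants of this section depends on the mesh h or on the number of points; this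
    is what makes the passage to the continuum possible. *)
Section Apriori.
Variables (R : realType) (n : nat) (h mu omega c : R).
Hypotheses (h_gt0 : 0 < h) (c_gt0 : 0 < c) (L_ge1 : 1 <= h * n.+2%:R).
Hypothesis coercive : forall s t : R,
  c * (s ^+ 2 + t ^+ 2) <= s ^+ 2 + mu * (t * s) + omega * t ^+ 2.

Local Notation isum := (@lattice_sum R n h).
Local Notation lap := (@lattice_lap R n h).
Local Notation fwd := (@forward_diff R n h).
Local Notation energy := (@lattice_energy R n h mu omega).
Local Notation quartic := (@lattice_quartic R n h).
Local Notation euler := (@lattice_euler R n h mu omega).

Lemma forward_diff_forward_diff u i : fwd (fwd u) i = lap u (i + 1).
Proof. by rewrite /forward_diff /lattice_lap addrK; field; rewrite gt_eqF. Qed.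

Lemma lattice_sum_fwd_sq_le a b u : isum (fun i => u i ^+ 2) <= a ->
  isum (fun i => lap u i ^+ 2) <= b -> isum (fun i => fwd u i ^+ 2) <= (a + b) / 2.
Proof.
move=> ua ub; rewrite lattice_sum_fwd_sq// -mulN1r -lattice_sumZ.
apply: (@le_trans _ _ (isum (fun i => 2^-1 * (u i ^+ 2 + lap u i ^+ 2)))).
  by apply: le_lattice_sum => // i; have := sqr_ge0 (u i + lap u i); rewrite sqrrD; lra.
by rewrite lattice_sumZ lattice_sumD; lra.
Qed.

(** The sup norm of u costs the square sum of Du, that of Du costs the square sum of the second
    difference, and the square sum of Du interpolates between the other two. *)
Lemma sobolev_chain a b u : isum (fun i => u i ^+ 2) <= a ->
  isum (fun i => lap u i ^+ 2) <= b ->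
  (forall i, u i ^+ 2 <= 4 * (a + b)) /\ (forall i, fwd u i ^+ 2 <= 4 * (a + b)).
Proof.
move=> ua ub; have fu := lattice_sum_fwd_sq_le ua ub.
have a0 : 0 <= a by apply: le_trans ua; apply: lattice_sum_ge0 => // k; exact: sqr_ge0.
have b0 : 0 <= b by apply: le_trans ub; apply: lattice_sum_ge0 => // k; exact: sqr_ge0.
split; apply: (lattice_sobolev h_gt0 L_ge1) => //; try lra.
rewrite (eq_lattice_sum h (v := fun i => lap u (i + 1) ^+ 2)).
  by rewrite (lattice_sum_shift _ 1 (fun i => lap u i ^+ 2)); lra.
by move=> i; rewrite forward_diff_forward_diff.
Qed.

Lemma norm_le_of_sqr (x B : R) : x ^+ 2 <= B -> 1 <= B -> `|x| <= B.
Proof.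
move=> xB B1; rewrite -real_normK ?num_real// in xB.
have := normr_ge0 x; move: `|x| xB => y yB y0; nra.
Qed.

Lemma norm_sub3_le (x y z a b d : R) :
  `|x| <= a -> `|y| <= b -> `|z| <= d -> `|x - y - z| <= a + b + d.
Proof.
move=> xa yb zd; apply: (le_trans (ler_normB _ _)); apply: lerD => //.
by apply: (le_trans (ler_normB _ _)); apply: lerD.
Qed.

Section Critical.
Variables (K : R) (u : 'I_n.+2 -> R).
Hypotheses (uE : forall j, euler u j = u j ^+ 3) (ueq : energy u = quartic u).
Hypotheses (u0 : 0 < quartic u) (uK : quartic u <= K).

Let A0 := K / c.
Let A1 := 3 * ((8 * A0) ^+ 2 + mu ^+ 2 + omega ^+ 2) * A0.
Let B := 1 + 4 * (2 * A0 + A1).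
Definition apriori_bound := 3 * B ^+ 3 + (`|mu| + `|omega| + 1) * B.

(** The energy controls u, Du and hence u^3; the equation then controls the fourth difference in
    the mean, and the Sobolev inequality applied to Lap u controls the second and third. *)
Lemma critical_bounds : [/\ isum (fun i => u i ^+ 2) <= A0,
  forall i, `|u i| <= B, forall i, `|fwd u i| <= B,
  forall i, `|lap u i| <= B & forall i, `|fwd (lap u) i| <= B].
Proof.
have K0 : 0 <= K by exact: le_trans (ltW u0) uK.
have A0_ge0 : 0 <= A0 by rewrite divr_ge0// ltW.
have coe := energy_coercive h_gt0 coercive u.
have lq : isum (fun i => lap u i ^+ 2) + isum (fun i => u i ^+ 2) <= A0.
  by rewrite ler_pdivlMr// mulrC; apply: (le_trans coe); rewrite ueq.
have sq w : 0 <= isum (fun i => w i ^+ 2) by apply: lattice_sum_ge0 => // i; exact: sqr_ge0.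
have u2 : isum (fun i => u i ^+ 2) <= A0 by have := sq (lap u); lra.
have l2 : isum (fun i => lap u i ^+ 2) <= A0 by have := sq u; lra.
have [uB fB] := sobolev_chain u2 l2.
have ll2 : isum (fun i => lap (lap u) i ^+ 2) <= A1.
  apply: (@le_trans _ _ (isum (fun i => 3 * (((8 * A0) ^+ 2 + omega ^+ 2) * u i ^+ 2 +
      mu ^+ 2 * lap u i ^+ 2)))); last first.
    rewrite lattice_sumZ lattice_sumD !lattice_sumZ /A1 -mulrA ler_pM2l//.
    rewrite [leRHS](_ : _ = ((8 * A0) ^+ 2 + omega ^+ 2) * A0 + mu ^+ 2 * A0); last by ring.
    by apply: lerD; apply: ler_wpM2l; rewrite ?addr_ge0 ?sqr_ge0.
  apply: le_lattice_sum => // i; have := uE i; rewrite /lattice_euler => H.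
  have -> : lap (lap u) i = u i ^+ 3 - mu * lap u i - omega * u i by rewrite -H; ring.
  have u6 : (u i ^+ 3) ^+ 2 <= (8 * A0) ^+ 2 * u i ^+ 2.
    rewrite [leLHS](_ : _ = (u i ^+ 2) ^+ 2 * u i ^+ 2); last by ring.
    rewrite ler_wpM2r ?sqr_ge0// lerXn2r ?nnegrE ?sqr_ge0//; first lra.
    by have := uB i; lra.
  move: u6; set x := u i ^+ 3; set y := mu * lap u i; set z := omega * u i => u6.
  have -> : mu ^+ 2 * lap u i ^+ 2 = y ^+ 2 by rewrite /y; ring.
  have -> : ((8 * A0) ^+ 2 + omega ^+ 2) * u i ^+ 2 = (8 * A0) ^+ 2 * u i ^+ 2 + z ^+ 2.
    by rewrite /z; ring.
  have := sqr_ge0 (x + y); have := sqr_ge0 (x + z); have := sqr_ge0 (y - z).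
  have -> : (x - y - z) ^+ 2 = 3 * (x ^+ 2 + y ^+ 2 + z ^+ 2)
    - (x + y) ^+ 2 - (x + z) ^+ 2 - (y - z) ^+ 2 by ring.
  lra.
have A1_ge0 : 0 <= A1 by apply: le_trans ll2.
have [lB flB] := sobolev_chain l2 ll2.
have B1 : 1 <= B by rewrite /B; lra.
by split => // i; apply: norm_le_of_sqr => //; [apply: le_trans (uB i) _|
 apply: le_trans (fB i) _|apply: le_trans (lB i) _|apply: le_trans (flB i) _];
  rewrite /B; lra.
Qed.

(** The equation expresses the fourth difference through u and Lap u, so that its own difference
    is bounded as well. *)
Lemma critical_higher_bounds : [/\ forall i, `|lap (lap u) i| <= apriori_bound,
   forall i, `|fwd (lap (lap u)) i| <= apriori_bound & B <= apriori_bound].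
Proof.
have [_ uB fB lB flB] := critical_bounds.
have B0 : 0 <= B by apply: le_trans (uB 0).
have B1 : 1 <= B.
  have A0_ge0 : 0 <= A0 by rewrite divr_ge0// ?(ltW c_gt0)//; exact: le_trans (ltW u0) uK.
  have : 0 <= A1 by rewrite /A1 mulr_ge0// mulr_ge0// !addr_ge0 ?sqr_ge0.
  by rewrite /B; lra.
have B3 : 0 <= B ^+ 3 by exact: exprn_ge0.
have mB := mulr_ge0 (normr_ge0 mu) B0; have oB := mulr_ge0 (normr_ge0 omega) B0.
have llE i : lap (lap u) i = u i ^+ 3 - mu * lap u i - omega * u i.
  by rewrite -uE /lattice_euler; ring.
split; last by rewrite /apriori_bound !mulrDl mul1r; lra.
- move=> i; rewrite llE; apply: (@le_trans _ _ (B ^+ 3 + `|mu| * B + `|omega| * B)).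
    apply: norm_sub3_le; first by rewrite normrX lerXn2r// nnegrE.
      by rewrite normrM ler_wpM2l.
    by rewrite normrM ler_wpM2l.
  by rewrite /apriori_bound -addrA !(mulrDl _ _ B) mul1r lerD ?lerDl// ler_peMl// ler1n.
move=> i.
have -> : fwd (lap (lap u)) i = fwd u i * (u (i + 1) ^+ 2 + u (i + 1) * u i + u i ^+ 2)
    - mu * fwd (lap u) i - omega * fwd u i.
  by rewrite /forward_diff !llE; field; rewrite gt_eqF.
apply: (@le_trans _ _ (3 * B ^+ 3 + `|mu| * B + `|omega| * B)); last first.
  by rewrite /apriori_bound -addrA !(mulrDl _ _ B) mul1r lerD2l lerDl.
apply: norm_sub3_le.
- rewrite normrM [leRHS](_ : _ = B * (B * B + B * B + B * B)); last by ring.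
  rewrite ler_pM//; apply: (le_trans (ler_normD _ _)); rewrite lerD//.
    by apply: (le_trans (ler_normD _ _)); rewrite lerD// ?expr2 normrM ler_pM.
  by rewrite expr2 normrM ler_pM.
- by rewrite normrM ler_wpM2l.
- by rewrite normrM ler_wpM2l.
Qed.

(** If u^2 were below c / 2 everywhere, the quartic would be at most half of the energy, to which
    it is equal. *)
Lemma critical_peak : exists i, c / 2 <= u i ^+ 2.
Proof.
apply: contrapT => nu.
have ui i : u i ^+ 2 <= c / 2.
  by rewrite leNgt; apply/negP => ui; apply: nu; exists i; exact: ltW.
have : quartic u <= isum (fun i => c / 2 * u i ^+ 2).
  apply: le_lattice_sum => // i; rewrite (_ : u i ^+ 4 = u i ^+ 2 * u i ^+ 2); last by ring.
  by rewrite ler_wpM2r// sqr_ge0.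
rewrite lattice_sumZ.
have sq w : 0 <= isum (fun i => w i ^+ 2) by apply: lattice_sum_ge0 => // i; exact: sqr_ge0.
have := energy_coercive h_gt0 coercive u; rewrite ueq mulrDr.
have := mulr_ge0 (ltW c_gt0) (sq (lap u)).
move: (quartic u) u0 (isum (fun i => u i ^+ 2)) (c * isum _) => q q0 s t; nra.
Qed.
End Critical.
End Apriori.

(** * A test function of bounded energy *)

Section Bump.
Variable R : realType.

(** Of class C^1 with a bounded second derivative, which is all that an energy with two
    derivatives requires. *)
Definition bump (x : R) : R := if (0 <= x) && (x <= 1) then x ^+ 2 * (1 - x) ^+ 2 else 0.

Lemma bump_le0 x : x <= 0 -> bump x = 0.
Proof.
rewrite /bump le_eqVlt => /predU1P[->|x0]; first by rewrite expr0n mul0r if_same.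
by rewrite (leNgt 0 x) x0.
Qed.

Lemma bump_ge1 x : 1 <= x -> bump x = 0.
Proof.
rewrite /bump le_eqVlt => /predU1P[<-|x0]; first by rewrite subrr expr0n mulr0 if_same.
by rewrite (leNgt x 1) x0 andbF.
Qed.

Lemma bumpE x : 0 <= x <= 1 -> bump x = x ^+ 2 * (1 - x) ^+ 2.
Proof. by rewrite /bump => ->. Qed.

Lemma bump_itv x : 0 <= bump x <= 1.
Proof.
rewrite /bump; case: ifP => [/andP[x0 x1]|_]; last by rewrite lexx ler01.
rewrite mulr_ge0 ?sqr_ge0//= mulr_ile1 ?sqr_ge0//; apply: exprn_ile1; lra.
Qed.

(** The points 0 and 1 lie on the lattice, so that a second difference never straddles them:
    either the three values come from the polynomial, or at least two of them vanish. *)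
Lemma bump_second_difference (h x : R) : 0 < h -> h <= 1 ->
  x <= - h \/ x = 0 \/ h <= x <= 1 - h \/ x = 1 \/ 1 + h <= x ->
  `|bump (x + h) - 2 * bump x + bump (x - h)| <= 16 * h ^+ 2.
Proof.
move=> h0 h1.
have hh : h ^+ 2 * (1 - h) ^+ 2 <= 16 * h ^+ 2.
  rewrite mulrC ler_wpM2r ?sqr_ge0//; nra.
have hh0 : 0 <= h ^+ 2 * (1 - h) ^+ 2 by rewrite mulr_ge0 ?sqr_ge0.
have h2 : 0 <= 16 * h ^+ 2 by rewrite mulr_ge0 ?sqr_ge0.
case => [xh|[->|[/andP[xh x1]|[->|xh]]]].
- by rewrite !bump_le0 ?mulr0 ?subrr ?addr0 ?normr0//; lra.
- rewrite add0r sub0r (@bump_le0 0)// (@bump_le0 (- h)) ?oppr_le0 ?(ltW h0)//.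
  by rewrite bumpE ?(ltW h0) ?h1// mulr0 subr0 addr0 ger0_norm.
- rewrite !bumpE; try (apply/andP; split; lra).
  rewrite [X in `|X|](_ : _ = (12 * x ^+ 2 - 12 * x + 2 + 2 * h ^+ 2) * h ^+ 2); last by ring.
  rewrite normrM [X in _ * X]ger0_norm ?sqr_ge0// ler_wpM2r ?sqr_ge0// ler_norml.
  by apply/andP; split; nra.
- rewrite (@bump_ge1 1)// (@bump_ge1 (1 + h)) ?lerDl ?(ltW h0)//.
  rewrite bumpE; last by apply/andP; split; lra.
  have -> : 1 - (1 - h) = h by ring.
  by rewrite mulr0 subr0 add0r mulrC ger0_norm.
- by rewrite !bump_ge1 ?mulr0 ?subrr ?addr0 ?normr0//; lra.
Qed.

Section OnLattice.
Variables (m n : nat).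
Hypotheses (m_gt0 : (0 < m)%N) (mn : (m + 3 <= n.+2)%N).
Let h : R := m%:R^-1.

Let h_gt0 : 0 < h. Proof. by rewrite invr_gt0 ltr0n. Qed.
Let mh : m%:R * h = 1. Proof. by rewrite mulfV// pnatr_eq0 -lt0n. Qed.
Let h_le1 : h <= 1. Proof. by rewrite invf_le1 ?ltr0n// ler1n. Qed.

Local Notation pos j := ((j%:R - 1) * h).

(** The bump starts at the index 1, so that the wrap-around of the cycle falls where it is zero. *)
Definition bump_seq (i : 'I_n.+2) : R := bump (pos (i : nat)).

Let val_add1 (i : 'I_n.+2) : nat_of_ord (i + 1)%R = if (i == n.+1 :> nat) then 0%N else i.+1.
Proof.
rewrite /= modnDmr addn1; case: eqP => [->|/eqP ni]; first by rewrite modnn.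
by rewrite modn_small// ltnS ltn_neqAle ni -ltnS ltn_ord.
Qed.

Let val_sub1 (i : 'I_n.+2) : nat_of_ord (i - 1)%R = if (i == 0%N :> nat) then n.+1 else i.-1.
Proof.
have H := val_add1 (i - 1); rewrite subrK in H.
case: ifP H => [/eqP -> -> //|_ ->]; by rewrite /=.
Qed.

Let pos_ge1 j : (m < j)%N -> 1 <= pos j.
Proof. by move=> mj; rewrite -{1}mh ler_pM2r// lerBrDr natr1 ler_nat. Qed.

Lemma bump_seqD1 i : bump_seq (i + 1) = bump (pos i + h).
Proof.
have -> : pos (i : nat) + h = pos i.+1 by rewrite -natr1; ring.
rewrite /bump_seq val_add1; case: eqP => // ->.
rewrite bump_le0; last by rewrite mulr_le0_ge0 ?(ltW h_gt0)// sub0r oppr_le0.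
by rewrite bump_ge1// pos_ge1//; move: mn; lia.
Qed.

Lemma bump_seqB1 i : bump_seq (i - 1) = bump (pos i - h).
Proof.
rewrite /bump_seq val_sub1; case: eqP => [->|/eqP i0]; last first.
  by rewrite -[in RHS](prednK (n := i)) ?lt0n// -[in RHS]natr1; congr bump; ring.
rewrite bump_ge1; last by rewrite pos_ge1//; move: mn; lia.
by rewrite bump_le0//; move: h_gt0; lra.
Qed.

Lemma lap_bump i : `|lattice_lap h bump_seq i| <= 16 * (0 < i < m + 2)%N%:R.
Proof.
rewrite /lattice_lap bump_seqD1 bump_seqB1.
have -> : bump_seq i = bump (pos (i : nat)) by [].
have [/andP[i0 im]|] := boolP (0 < i < m + 2)%N.
  rewrite mulr1 normrM normfV [X in _ / X]ger0_norm ?sqr_ge0// ler_pdivrMr ?exprn_gt0//.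
  apply: bump_second_difference => //.
  (* The indices 1 and m + 1 are the end points 0 and 1 of the support. *)
  have [i1|i1] := eqVneq (i : nat) 1%N.
    by right; left; rewrite i1 subrr mul0r.
  have [i2|i2] := eqVneq (i : nat) (m + 1)%N.
    by do 3 right; left; rewrite i2 addn1 -natr1 addrK.
  right; right; left; apply/andP; split.
    rewrite -[leLHS]mul1r ler_pM2r// lerBrDr (_ : 1 + 1 = 2%:R)// ler_nat.
    by move: i0 i1; case: (i : nat) => [|[|]].
  rewrite (_ : 1 - h = (m%:R - 1) * h); last by rewrite mulrBl mh mul1r.
  rewrite ler_pM2r// lerB// ler_nat.
  by move: im i2; rewrite addn2 addn1 !ltnS leq_eqVlt => /orP[->//|].
rewrite negb_and -leqNgt -leqNgt => H; rewrite mulr0.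
set X := (X in Num.norm X); have -> : X = 0; last by rewrite normr0. rewrite /X.
case/orP: H => [|im].
  rewrite leqn0 => /eqP ->; rewrite !bump_le0 ?mulr0 ?subrr ?addr0 ?mul0r//; move: h_gt0; lra.
have p1 : 1 + h <= pos (i : nat).
  rewrite (_ : 1 + h = (m%:R + 1) * h); last by rewrite mulrDl mh mul1r.
  by rewrite ler_pM2r// lerBrDr !natr1 ler_nat -addn2.
rewrite !bump_ge1 ?mulr0 ?subrr ?addr0 ?mul0r//; move: h_gt0 p1; lra.
Qed.

Lemma bump_seq_le i : `|bump_seq i| <= (0 < i < m + 2)%N%:R.
Proof.
have [/andP[i0 im]|] := boolP (0 < i < m + 2)%N.
  by rewrite ger0_norm; have /andP[] := bump_itv (pos (i : nat)).
rewrite negb_and -leqNgt -leqNgt /bump_seq => /orP[|im].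
  rewrite leqn0 => /eqP ->; rewrite bump_le0 ?normr0//; move: h_gt0; lra.
by rewrite bump_ge1 ?normr0// pos_ge1// (leq_trans _ im)// addn2.
Qed.

Lemma lattice_sum_window : lattice_sum (n := n) h (fun i => (0 < i < m + 2)%N%:R) <= 2.
Proof.
rewrite /lattice_sum; apply: (@le_trans _ _ (h * (m + 1)%:R)); last first.
  by rewrite natrD mulrDr mulrC mh mulr1; move: h_le1; lra.
rewrite ler_pM2l// -natr_sum ler_nat.
rewrite -(big_mkord xpredT (fun i => (0 < i < m + 2)%N : nat)).
rewrite (big_cat_nat (n := m + 2))//=; last by rewrite (leq_trans _ mn)// leq_add2l.
rewrite [X in (_ + X)%N]big_nat_cond [X in (_ + X)%N]big1 ?addn0; last first.
  by move=> i /andP[/andP[mi _] _]; rewrite (ltnNge i) mi andbF.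
rewrite addn2 big_nat_recl//= addn1.
apply: (@leq_trans (\sum_(0 <= i < m.+1) 1)); first by apply: leq_sum => i _; exact: leq_b1.
by rewrite sum_nat_const_nat subn0 muln1.
Qed.

Lemma bump_energy_le mu omega :
  lattice_energy h mu omega bump_seq <= 2 * (256 + 16 * `|mu| + `|omega|).
Proof.
apply: (@le_trans _ _ (lattice_sum h (fun i : 'I_n.+2 =>
    (256 + 16 * `|mu| + `|omega|) * (0 < i < m + 2)%N%:R))).
  apply: le_lattice_sum => // i; have := lap_bump i; have := bump_seq_le i.
  move: (lattice_lap h bump_seq i) (bump_seq i) (0 < i < m + 2)%N => l v b vb lb.
  have b01 : b%:R * b%:R = b%:R :> R by case: b {vb lb}; rewrite ?mulr1 ?mulr0.
  have b0 : 0 <= b%:R :> R by [].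
  have E1 : l ^+ 2 <= 256 * b%:R.
    rewrite -real_normK ?num_real// (_ : 256 * b%:R = (16 * b%:R) ^+ 2);
        last by rewrite exprMn (expr2 b%:R) b01; ring.
    by rewrite lerXn2r ?nnegrE ?mulr_ge0.
  have E2 : mu * (v * l) <= 16 * `|mu| * b%:R.
    apply: (le_trans (ler_norm _)); rewrite !normrM.
    rewrite (_ : 16 * _ * _ = `|mu| * (b%:R * (16 * b%:R))); last by rewrite (mulrCA b%:R) b01;
        ring.
    by rewrite ler_wpM2l// ler_pM.
  have E3 : omega * v ^+ 2 <= `|omega| * b%:R.
    apply: (le_trans (ler_norm _)); rewrite normrM normrX ler_wpM2l// -b01 -expr2.
    by rewrite lerXn2r ?nnegrE.
  rewrite [leRHS](_ : _ = 256 * b%:R + 16 * `|mu| * b%:R + `|omega| * b%:R); last by ring.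
  by apply: lerD => //; apply: lerD.
rewrite lattice_sumZ mulrC; apply: ler_wpM2r; last exact: lattice_sum_window.
by have := normr_ge0 mu; have := normr_ge0 omega; lra.
Qed.

(** On the middle half of its support the bump is at least 1 / 64, and that half contains at least
    2 k points at distance 1 / (4 k). *)
Lemma bump_quartic_ge k : m = (4 * k)%N -> 64 ^- 4 / 2 <= lattice_quartic h bump_seq.
Proof.
move=> mk.
have k4 : k%:R * h = 4^-1 by move: mh; rewrite mk natrM; lra.
apply: (@le_trans _ _ (h * \sum_(k.+1 <= j < (3 * k).+1) (64 : R) ^- 4)).
  rewrite sumr_const_nat (_ : (_ - _ = 2 * k)%N); last by lia.
  rewrite -[_ *+ (2 * k)]mulr_natr natrM; move: (64 ^- 4 : R) => q.
  by rewrite mulrCA (mulrC h) -mulrA k4; lra.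
rewrite /lattice_quartic /lattice_sum ler_pM2l// -(big_mkord xpredT (fun j => bump (pos j) ^+ 4)).
rewrite (big_cat_nat (n := k.+1) (m := 0%N))//=; last first.
  by rewrite (leq_trans _ mn)// mk addn3 ltnS; lia.
rewrite [X in _ <= _ + X](big_cat_nat (n := (3 * k).+1))//=; last 2 first.
  by rewrite ltnS leq_pmull.
  by rewrite (leq_trans _ mn)// mk addn3; lia.
have b0 j : 0 <= bump (pos j) ^+ 4 by rewrite exprn_ge0//; have /andP[] := bump_itv (pos j).
rewrite ler_wpDl ?sumr_ge0// ler_wpDr ?sumr_ge0//.
apply: ler_sum_nat => j /andP[kj jk].
have x1 : 4^-1 <= pos j by rewrite -k4 ler_pM2r// lerBrDr natr1 ler_nat.
have x2 : pos j <= 3 / 4.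
  rewrite -k4 mulrA -natrM ler_pM2r// lerBlDr natr1 ler_nat; lia.
rewrite -exprVn lerXn2r ?nnegrE//; first by have /andP[] := bump_itv (pos j).
rewrite bumpE; last by apply/andP; split; lra.
move: x1 x2; move: (pos j) => x x1 x2.
have : 8^-1 <= x * (1 - x) by nra.
by move=> y; rewrite -exprMn; nra.
Qed.
End OnLattice.
End Bump.

(** * Lattice solutions as sequences on the integers *)

(** A lattice solution and its first four differences, as sequences on the integers.  Since the
    second difference is centred, every other relation carries a shift.  J is the sum of h f0^2
    from a far away point on; on a cycle it can be a primitive in a bounded window only, of half
    width L, if it is to be bounded by the mass A of one period. *)
Record lattice_profile (R : realType) (mu omega h L M A c : R) (f0 f1 f2 f3 f4 J : int -> R) :
    Prop :=
 LatticeProfile {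
  lp_eq : forall k, f4 k + mu * f2 k + omega * f0 k = f0 k ^+ 3;
  lp_d0 : forall k, f0 (k + 1) - f0 k = h * f1 k;
  lp_d1 : forall k, f1 (k + 1) - f1 k = h * f2 (k + 1);
  lp_d2 : forall k, f2 (k + 1) - f2 k = h * f3 k;
  lp_d3 : forall k, f3 (k + 1) - f3 k = h * f4 (k + 1);
  lp_lip4 : forall k, `|f4 (k + 1) - f4 k| <= M * h;
  lp_bnd : forall k, [/\ `|f0 k| <= M, `|f1 k| <= M, `|f2 k| <= M, `|f3 k| <= M & `|f4 k| <= M];
  lp_peak : c <= f0 0 ^+ 2;
  lp_mass : forall k, 0 <= J k <= A;
  lp_dJ : forall k, `|k%:~R| * h < L -> J (k + 1) - J k = h * f0 k ^+ 2 }.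

Section Profile.
Variables (R : realType) (mu omega c : R).
Hypothesis c_gt0 : 0 < c.
Hypothesis coercive : forall s t : R,
  c * (s ^+ 2 + t ^+ 2) <= s ^+ 2 + mu * (t * s) + omega * t ^+ 2.

(** The sequences are the pull-backs of u along k |-> i0 + k, which are periodic. *)
Lemma lattice_profile_of_critical_point n (h L M A d : R) (P : nat) (u : 'I_n.+2 -> R) i0 :
  0 < h -> (2 * P <= n.+2)%N -> L <= P%:R * h ->
  (forall j, lattice_euler h mu omega u j = u j ^+ 3) ->
  lattice_sum h (fun i => u i ^+ 2) <= A ->
  (forall i, [/\ `|u i| <= M, `|forward_diff h u i| <= M, `|lattice_lap h u i| <= M,
     `|forward_diff h (lattice_lap h u) i| <= M & `|lattice_lap h (lattice_lap h u) i| <= M]) ->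
  (forall i, `|forward_diff h (lattice_lap h (lattice_lap h u)) i| <= M) ->
  d <= u i0 ^+ 2 ->
  exists f0 f1 f2 f3 f4 J, lattice_profile mu omega h L M A d f0 f1 f2 f3 f4 J.
Proof.
move=> h0 Pn LP uE uA ub ub5 ud.
pose pull (w : 'I_n.+2 -> R) (k : int) := w (i0 + k%:~R).
have pull1 w k : pull w (k + 1) = w (i0 + k%:~R + 1) by rewrite /pull intrD addrA.
have pullfwd w k : pull w (k + 1) - pull w k = h * pull (forward_diff h w) k.
  by rewrite pull1 /pull /forward_diff; field; rewrite gt_eqF.
(* The window starts at - P, so that its far end is at distance P at least on either side. *)
pose J (k : int) := h * \sum_(l < n.+2)
  (if (l%:Z < k + P%:Z)%R then pull u (l%:Z - P%:Z) ^+ 2 else 0).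
exists (pull u), (pull (forward_diff h u)), (pull (lattice_lap h u)),
  (pull (forward_diff h (lattice_lap h u))), (pull (lattice_lap h (lattice_lap h u))), J; split.
- by move=> k; exact: uE.
- exact: pullfwd.
- by move=> k; rewrite pullfwd {1}/pull forward_diff_forward_diff// -pull1.
- exact: pullfwd.
- by move=> k; rewrite pullfwd {1}/pull forward_diff_forward_diff// -pull1.
- by move=> k; rewrite pullfwd normrM gtr0_norm// mulrC ler_pM2r//; exact: ub5.
- by move=> k; exact: ub.
- by rewrite /pull addr0.
- move=> k; apply/andP; split.
    by rewrite mulr_ge0 ?(ltW h0)// sumr_ge0// => l _; case: ifP => // _; exact: sqr_ge0.
  apply: le_trans uA; rewrite /lattice_sum ler_pM2l//.
  rewrite -(sum_along_cycle (fun i => u i ^+ 2) (i0 - P%:R)); apply: ler_sum => l _.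
  have -> : pull u (l%:Z - P%:Z) = u (i0 - P%:R + (l : nat)%:R).
    by rewrite /pull intrB -!pmulrn -addrA [- _ + _]addrC.
  by case: ifP => // _; exact: sqr_ge0.
- move=> k kL; rewrite /J -mulrBr -sumrB; congr (_ * _).
  have kP : (`|k| < P)%N.
    have := lt_le_trans kL LP; rewrite ltr_pM2r// -intr_norm.
    by rewrite -abszE -pmulrn ltr_nat.
  have jP : (absz (k + P%:Z)%R < n.+2)%N by lia.
  rewrite (bigD1 (Ordinal jP))//= big1 ?addr0; last first.
    move=> l lj.
    have : l != absz (k + P%:Z)%R :> nat by move: lj; apply: contraNneq => lE; apply/eqP/val_inj.
    move=> {}lj; rewrite (_ : (l%:Z < k + 1 + P%:Z)%R = (l%:Z < k + P%:Z)%R) ?subrr//; lia.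
  have kp0 : (0 <= k + P%:Z)%R by lia.
  rewrite gez0_abs// ltxx subr0 addrK (_ : (k + P%:Z < k + 1 + P%:Z)%R)//; lia.
Qed.

(** The mesh is 1 / m with m = 4 (nu + 1), a multiple of 4 as the lower bound on the bump wants,
    and the period is about m, so that it tends to infinity while the mesh tends to 0. *)
Lemma lattice_profiles_exist : exists M A : R, 0 < M /\ forall nu : nat,
  exists f0 f1 f2 f3 f4 J, lattice_profile mu omega (4 * nu.+1)%:R^-1 nu.+1%:R M A (c / 2)
    f0 f1 f2 f3 f4 J.
Proof.
pose K := (2 * (256 + 16 * `|mu| + `|omega|)) ^+ 2 / (64 ^- 4 / 2).
exists (apriori_bound mu omega c K), (K / c); split.
  have K0 : 0 <= K.
    by rewrite divr_ge0 ?sqr_ge0.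
  have B0 : 1 <= 1 + 4 * (2 * (K / c) + 3 * ((8 * (K / c)) ^+ 2 + mu ^+ 2 + omega ^+ 2) * (K / c)).
    have Kc : 0 <= K / c by rewrite divr_ge0// ltW.
    rewrite lerDl mulr_ge0// addr_ge0// mulr_ge0//.
    by rewrite mulr_ge0// !addr_ge0// sqr_ge0.
  rewrite /apriori_bound; move: (1 + _) B0 => B B1.
  have B0 := lt_le_trans ltr01 B1.
  by rewrite ltr_pwDl ?mulr_gt0 ?exprn_gt0// mulr_ge0 ?(ltW B0)// !addr_ge0.
move=> nu; set m := (4 * nu.+1)%N; set h := m%:R^-1 : R; pose n := (m * m + m + 1)%N.
have m0 : (0 < m)%N by [].
have h0 : 0 < h by rewrite invr_gt0 ltr0n.
have mn : (m + 3 <= n.+2)%N by rewrite /n; nia.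
have mh : m%:R * h = 1 by rewrite mulfV// pnatr_eq0 -lt0n.
have L1 : 1 <= h * n.+2%:R.
  by rewrite -[leLHS]mh mulrC ler_pM2l// ler_nat; apply: leq_trans mn; lia.
have q0 := bump_quartic_ge R m0 mn (erefl : m = (4 * nu.+1)%N).
have q1 : 0 < lattice_quartic (n := n) m%:R^-1 (bump_seq R m (n:=n)).
  by apply: lt_le_trans q0; rewrite divr_gt0.
have e0 : 0 <= lattice_energy (n := n) h mu omega (bump_seq R m (n:=n)).
  apply: le_trans (energy_coercive h0 coercive _).
  by rewrite mulr_ge0 ?(ltW c_gt0)// addr_ge0//; apply: lattice_sum_ge0 => // i; exact: sqr_ge0.
have e1 := bump_energy_le m0 mn mu omega.
have eK : lattice_energy (n := n) h mu omega (bump_seq R m (n:=n)) ^+ 2 <= K * lattice_quartic (n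
    := n) h (bump_seq R m (n:=n)).
  rewrite /K; move: (2 * (256 + 16 * `|mu| + `|omega|)) e1 => E1 e1.
  apply: (@le_trans _ _ (E1 ^+ 2)).
    by rewrite lerXn2r ?nnegrE//; apply: le_trans e1.
  rewrite mulrAC -mulrA ler_peMr ?sqr_ge0//.
  by rewrite ler_pdivlMr ?divr_gt0// mul1r.
have [u [uE ueq u0 uK]] := critical_point_exists h0 c_gt0 coercive q1 eK.
have [u2 b0 b1 b2 b3] := critical_bounds h0 c_gt0 L1 coercive uE ueq u0 uK.
have [b4 b5 B] := critical_higher_bounds h0 c_gt0 L1 coercive uE ueq u0 uK.
have [i0 peak] := critical_peak h0 c_gt0 coercive ueq u0.
apply: (@lattice_profile_of_critical_point n h nu.+1%:R _ _ _ (m * nu.+1)%N u i0 h0) => //.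
- apply: (@leq_trans (m * m)); first by rewrite mulnCA leq_mul// /m leq_mul2r.
  by rewrite /n -addnA -2!addnS leq_addr.
- by rewrite natrM mulrAC mh mul1r.
- move=> i; split.
  + exact: le_trans (b0 i) B.
  + exact: le_trans (b1 i) B.
  + exact: le_trans (b2 i) B.
  + exact: le_trans (b3 i) B.
  + exact: b4.
Qed.
End Profile.

(** * Ultrafilter limits of lattice functions *)

Section UltraLimit.
Variable R : realType.

(** The hypotheses only look to the right of the base point.  The Lipschitz bound on g moves the
    base point to the other end of the interval and so covers the left. *)
Lemma is_derive_of_taylor (f g : R -> R) (M : R) :
  (forall x y, x < y -> `|f y - f x - (y - x) * g x| <= M * (y - x) ^+ 2) ->
  (forall x y, x < y -> `|g y - g x| <= M * (y - x)) ->
  forall x : R, is_derive x 1 f (g x).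
Proof.
move=> fT gL x.
have M0 : 0 <= M by have := gL 0 1 ltr01; rewrite subr0 mulr1; apply: le_trans.
have T t : `|f (x + t) - f x - t * g x| <= 2 * M * t ^+ 2.
  have Mt2 : 0 <= M * t ^+ 2 by rewrite mulr_ge0 ?sqr_ge0.
  have [t0|t0|->] := ltgtP t 0; last by rewrite addr0 subrr mul0r subrr normr0 expr0n !mulr0.
    have xt : x + t < x by rewrite gtrDl.
    have := fT _ _ xt; have := gL _ _ xt.
    rewrite opprD addrA subrr sub0r sqrrN => gx fx.
    rewrite (_ : f _ - _ - _ = - (f x - f (x + t) - (- t) * g (x + t)) + (- t) * (g x - g (x +
        t))); last by ring.
    apply: (le_trans (ler_normD _ _)); rewrite normrN normrM gtr0_norm ?oppr_gt0//.
    have : - t * `|g x - g (x + t)| <= - t * (M * - t) by rewrite ler_wpM2l// oppr_ge0 ltW.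
    lra.
  have xt : x < x + t by rewrite ltrDl.
  have := fT _ _ xt; rewrite [x + t - x]addrC addKr; lra.
suff H : t^-1 *: ((f \o shift x) (t *: 1) - f x) @[t --> 0^'] --> g x.
  by split; [apply/cvg_ex; exists (g x)|apply/cvg_lim].
apply/cvgrPdist_le => e e0; near=> t.
have t0 : t != 0 by near: t; exact: nbhs_dnbhs_neq.
have tn : 0 < `|t| by rewrite normr_gt0.
rewrite /= /shift/= [t *: 1]mulr1 [t + x]addrC.
rewrite (_ : g x - _ = - (t^-1 * (f (x + t) - f x - t * g x))); last first.
  rewrite /GRing.scale/=. by field.
rewrite normrN normrM normfV mulrC ler_pdivrMr//.
apply: (le_trans (T t)); rewrite -[t ^+ 2]real_normK ?num_real// expr2 mulrA ler_pM2r//.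
suff : `|t| <= e / (2 * M + 1).
  rewrite ler_pdivlMr; last by lra.
  move: `|t| tn => s s0; nra.
near: t; apply: dnbhs0_le; rewrite divr_gt0//; lra.
Unshelve. all: by end_near. Qed.

(** Summing the one step errors: j of size M h^2 from F and 1 + ... + (j - 1) of size M h^2 from the
    variation of G, at most j^2 in all. *)
Lemma discrete_taylor (F G : int -> R) (M h L : R) (k : int) (j : nat) : 0 <= h -> 0 <= M ->
  (forall i : int, `|i%:~R| * h < L -> `|F (i + 1) - F i - h * G i| <= M * h ^+ 2) ->
  (forall i : int, `|i%:~R| * h < L -> `|G (i + 1) - G i| <= M * h) ->
  `|k%:~R| * h + j%:R * h < L ->
  `|F (k + j%:Z) - F k - j%:R * h * G k| <= M * (j%:R * h) ^+ 2 /\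
  `|G (k + j%:Z) - G k| <= M * (j%:R * h).
Proof.
move=> h0 M0 FG Glip.
elim: j => [|j IH] jL; first by rewrite addr0 !subrr !mul0r subrr normr0 expr0n !mulr0.
have jL' : `|k%:~R| * h + j%:R * h < L.
  by apply: le_lt_trans jL; rewrite lerD2l ler_wpM2r// ler_nat.
have kjL : `|(k + j%:Z)%:~R| * h < L.
  apply: le_lt_trans jL'; rewrite -mulrDl ler_wpM2r// intrD.
  by apply: (le_trans (ler_normD _ _)); rewrite lerD2l -pmulrn normr_nat.
have [IH1 IH2] := IH jL'.
have S1 := FG _ kjL; have S2 := Glip _ kjL.
rewrite -natr1 (_ : k + j.+1%:Z = k + j%:Z + 1); last by rewrite -addrA -[j.+1]addn1 PoszD.
move: IH1 IH2 S1 S2; move: (k + j%:Z) => l.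
have nj : 0 <= j%:R :> R by [].
move: (j%:R : R) nj => r r0 IH1 IH2 S1 S2; split; last first.
  rewrite (_ : _ - G k = (G (l + 1) - G l) + (G l - G k)); last by ring.
  by apply: (le_trans (ler_normD _ _)); lra.
rewrite (_ : _ - _ - _ = (F l - F k - r * h * G k) + (F (l + 1) - F l - h * G l) + h * (G l - G
    k)); last by ring.
apply: (le_trans (ler_normD _ _)); rewrite normrM (ger0_norm h0).
apply: (@le_trans _ _ ((M * (r * h) ^+ 2 + M * h ^+ 2) + h * (M * (r * h)))).
  rewrite lerD ?ler_wpM2l//; apply: (le_trans (ler_normD _ _)); exact: lerD.
rewrite -subr_ge0 (_ : _ - _ = M * (r * h ^+ 2)); last by ring.
by rewrite !mulr_ge0 ?sqr_ge0.
Qed.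

Variable U : set_system nat.
Hypothesis UU : UltraFilter U.
Hypothesis Uoo : \oo `<=` U.
Let PU : ProperFilter U. Proof. exact: ultra_proper. Qed.

(** A cluster point of an ultrafilter is a limit. *)
Lemma ultra_cvg_bounded (a : nat -> R) (M : R) : (forall n, `|a n| <= M) -> cvg (a @ U).
Proof.
move=> aM.
have FF : ProperFilter (a @ U) by exact: fmap_proper_filter.
have aS : (a @ U) `[- M, M]%classic.
  suff : \forall n \near U, `[- M, M]%classic (a n) by [].
  by apply: (filterS _ filterT) => n _; have := aM n; rewrite ler_norml /= in_itv.
have [p [_ pc]] := segment_compact FF aS.
apply/cvg_ex; exists p => V Vp.
have [//|nV] := in_ultra_setVsetC (a @^-1` V) UU.
have [q []] := pc (~` V) V nV Vp; contradiction.
Qed.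

Definition mesh (n : nat) : R := (4 * n.+1)%:R^-1.
Definition node (n : nat) (x : R) : int := Num.floor (x / mesh n).

Lemma mesh_gt0 n : 0 < mesh n. Proof. by rewrite invr_gt0 ltr0n. Qed.

Lemma mesh_le1 n : mesh n <= 1.
Proof. by rewrite invf_le1 ?ltr0n// ler1n. Qed.

Lemma mesh_cvg : mesh @ U --> 0.
Proof.
apply: (@cvg_trans _ (mesh @ \oo)); first by move=> V; exact: Uoo.
have -> : mesh = (fun n => 4^-1 * harmonic n).
  by apply/funext => n; rewrite /mesh natrM invfM.
rewrite -(mulr0 4^-1); apply: cvgM; [exact: cvg_cst|exact: cvg_harmonic].
Qed.

Lemma node_bound n x : 0 <= x - (node n x)%:~R * mesh n <= mesh n.
Proof.
have h0 := mesh_gt0 n.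
have /andP[] := floor_itv (x / mesh n).
rewrite -/(node n x) ler_pdivlMr// ltr_pdivrMr// intrD mulrDl => k1 k2.
by apply/andP; split; lra.
Qed.

Lemma node_cvg x : (node n x)%:~R * mesh n @[n --> U] --> x.
Proof.
have H : (x - (node n x)%:~R * mesh n) @[n --> U] --> 0.
  apply: (@squeeze_cvgr _ _ _ _ (cst 0) mesh); [|exact: cvg_cst|exact: mesh_cvg].
  by apply: (filterS _ filterT) => n _; exact: node_bound.
have -> : (fun n => (node n x)%:~R * mesh n) = (fun n => x - (x - (node n x)%:~R * mesh n)).
  by apply/funext => n; ring.
by rewrite -[X in _ --> X]subr0; apply: cvgB => //; exact: cvg_cst.
Qed.

(** Both hypotheses are inequalities between lattice values, pointwise in the index, and they
    survive the limit.  They are only asked for in a window that exhausts the line, which is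
    what the primitive J of [lattice_profile] offers. *)
Lemma limit_is_derive (F G : nat -> int -> R) (f g : R -> R) (M : R) : 0 <= M ->
  (forall n (i : int), `|i%:~R| * mesh n < n.+1%:R ->
     `|F n (i + 1) - F n i - mesh n * G n i| <= M * mesh n ^+ 2) ->
  (forall n (i : int), `|i%:~R| * mesh n < n.+1%:R -> `|G n (i + 1) - G n i| <= M * mesh n) ->
  (forall x, F n (node n x) @[n --> U] --> f x) ->
  (forall x, G n (node n x) @[n --> U] --> g x) ->
  forall x : R, is_derive x 1 f (g x).
Proof.
move=> M0 FG Glip Ff Gg.
have key x y : x < y -> \forall n \near U,
   `|F n (node n y) - F n (node n x) - ((node n y)%:~R * mesh n - (node n x)%:~R * mesh n) * G n
       (node n x)|
     <= M * ((node n y)%:~R * mesh n - (node n x)%:~R * mesh n) ^+ 2 /\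
   `|G n (node n y) - G n (node n x)| <= M * ((node n y)%:~R * mesh n - (node n x)%:~R * mesh n).
  move=> xy; apply: Uoo; near=> n.
  have h0 := mesh_gt0 n.
  have kl : (node n x <= node n y)%R.
    by apply: le_floor; rewrite ler_pM2r ?invr_gt0// ltW.
  pose j := absz (node n y - node n x)%R.
  have jE : node n y = node n x + j%:Z by rewrite /j gez0_abs ?subr_ge0// addrC subrK.
  have jR : (node n y)%:~R * mesh n - (node n x)%:~R * mesh n = j%:R * mesh n.
    by rewrite jE intrD mulrDl -pmulrn addrAC subrr add0r.
  rewrite jR jE.
  apply: (@discrete_taylor (F n) (G n) M (mesh n) n.+1%:R) => //.
  - exact: ltW.
  - exact: FG.
  - exact: Glip.
  rewrite -jR.
  have nl : `|x| + (y - x) + 3 <= n.+1%:R.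
    near: n; exists (Num.truncn (`|x| + (y - x) + 3)) => //= n /= tn.
    apply/ltW/(lt_le_trans (truncnS_gt _)).
    by rewrite ler_nat ltnS.
  have /andP[a1 a2] := node_bound n x; have /andP[b1 b2] := node_bound n y.
  have h1 := mesh_le1 n.
  have : `|(node n x)%:~R| * mesh n <= `|x| + mesh n.
    rewrite -{1}(gtr0_norm h0) -normrM.
    rewrite (_ : _ * _ = x - (x - (node n x)%:~R * mesh n)); last by ring.
    by apply: (le_trans (ler_normB _ _)); rewrite lerD2l ger0_norm.
  move: (_ * mesh n) ((node n x)%:~R * mesh n) ((node n y)%:~R * mesh n) a1 a2 b1 b2 => *; lra.
have dn x y : ((node n y)%:~R * mesh n - (node n x)%:~R * mesh n) @[n --> U] --> y - x.
  by apply: cvgB; exact: node_cvg.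
apply: (@is_derive_of_taylor f g M) => x y xy.
  apply: (ler_cvg_to (a := U) _ _ (filterS (fun n => @proj1 _ _) (key _ _ xy))).
    apply: cvg_norm; apply: cvgB; first exact: cvgB.
    by apply: cvgM => //; exact: dn.
  apply: cvgM; first exact: cvg_cst.
  by rewrite expr2; under eq_fun do rewrite expr2; apply: cvgM; exact: dn.
apply: (ler_cvg_to (a := U) _ _ (filterS (fun n => @proj2 _ _) (key _ _ xy))).
  by apply: cvg_norm; apply: cvgB.
by apply: cvgM; [exact: cvg_cst|exact: dn].
Unshelve. all: by end_near. Qed.
End UltraLimit.

(** * A bounded solution of finite mass *)

Section LimitProfile.
Variables (R : realType) (mu omega c : R).
Hypothesis c_gt0 : 0 < c.
Hypothesis coercive : forall s t : R,
  c * (s ^+ 2 + t ^+ 2) <= s ^+ 2 + mu * (t * s) + omega * t ^+ 2.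

(** J is a bounded primitive of f0^2: it expresses that the limit has finite mass without
    integrating over the line. *)
Lemma bounded_profile_exists : exists (f0 f1 f2 f3 f4 J : R -> R) (M A : R),
  [/\ forall x : R, [/\ is_derive x 1 f0 (f1 x), is_derive x 1 f1 (f2 x),
        is_derive x 1 f2 (f3 x) & is_derive x 1 f3 (f4 x)],
      forall x, f4 x + mu * f2 x + omega * f0 x = f0 x ^+ 3,
      forall x, [/\ `|f0 x| <= M, `|f1 x| <= M, `|f2 x| <= M & `|f3 x| <= M],
      f0 0 <> 0 &
      forall x : R, is_derive x 1 J (f0 x ^+ 2) /\ 0 <= J x <= A].
Proof.
have [M [A [M0 H]]] := lattice_profiles_exist c_gt0 coercive.
have [U [UU Uoo]] : exists U, UltraFilter U /\ \oo `<=` U by exact: ultraFilterLemma.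
have PU : ProperFilter U by exact: ultra_proper.
have {}H n : exists p : (int -> R) * (int -> R) * (int -> R) * (int -> R) * (int -> R) * (int -> R),
    lattice_profile mu omega (mesh R n) n.+1%:R M A (c / 2)
      p.1.1.1.1.1 p.1.1.1.1.2 p.1.1.1.2 p.1.1.2 p.1.2 p.2.
  by have [f0 [f1 [f2 [f3 [f4 [J HJ]]]]]] := H n; exists (f0, f1, f2, f3, f4, J).
have [p pP] := choice H.
pose F0 n := (p n).1.1.1.1.1; pose F1 n := (p n).1.1.1.1.2.
pose F2 n := (p n).1.1.1.2; pose F3 n := (p n).1.1.2; pose F4 n := (p n).1.2.
pose FJ n := (p n).2.
have {pP}pP n : lattice_profile mu omega (mesh R n) n.+1%:R M A (c / 2)
    (F0 n) (F1 n) (F2 n) (F3 n) (F4 n) (FJ n) := pP n.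
clearbody F0 F1 F2 F3 F4 FJ => {H p}.
have b n k := lp_bnd (pP n) k.
pose ul (F : nat -> int -> R) (x : R) : R := lim (F n (node n x) @[n --> U]).
have ulP (F : nat -> int -> R) (B : R) : (forall n k, `|F n k| <= B) -> forall x, F n (node n x)
    @[n --> U] --> ul F x.
  by move=> FB x; apply: (ultra_cvg_bounded UU (M := B)) => n.
have cvg_pow k (a : nat -> R) (l : R) : a n @[n --> U] --> l -> a n ^+ k @[n --> U] --> l ^+ k.
  by move=> al; exact: (@continuous_cvg _ _ _ U _ a (fun y : R => y ^+ k) l (@exprn_continuous R
      k l) al).
have c0 := ulP F0 M (fun n k => let: And5 h _ _ _ _ := b n k in h).
have c1 := ulP F1 M (fun n k => let: And5 _ h _ _ _ := b n k in h).
have c2 := ulP F2 M (fun n k => let: And5 _ _ h _ _ := b n k in h).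
have c3 := ulP F3 M (fun n k => let: And5 _ _ _ h _ := b n k in h).
have c4 := ulP F4 M (fun n k => let: And5 _ _ _ _ h := b n k in h).
have cJ : forall x, FJ n (node n x) @[n --> U] --> ul FJ x.
  apply: (ulP _ A) => n k; have /andP[J0 JA] := lp_mass (pP n) k.
  by rewrite ger0_norm.
have hgt0 n := mesh_gt0 R n.
(* Each difference is h times the next sequence, hence all of them are h M-Lipschitz. *)
have incr (F G : nat -> int -> R) :
    (forall n k, F n (k + 1) - F n k = mesh R n * G n k \/
                 F n (k + 1) - F n k = mesh R n * G n (k + 1)) ->
    (forall n k, `|G n k| <= M) -> forall n k, `|F n (k + 1) - F n k| <= M * mesh R n.
  by move=> FG GM n k; case: (FG n k) => ->; rewrite normrM gtr0_norm// mulrC ler_pM2r.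
have l1 := incr F1 F2 (fun n k => or_intror (lp_d1 (pP n) k)) (fun n k => let: And5 _ _ h _ _ :=
    b n k in h).
have l2 := incr F2 F3 (fun n k => or_introl (lp_d2 (pP n) k)) (fun n k => let: And5 _ _ _ h _ :=
    b n k in h).
have l3 := incr F3 F4 (fun n k => or_intror (lp_d3 (pP n) k)) (fun n k => let: And5 _ _ _ _ h :=
    b n k in h).
have l0 := incr F0 F1 (fun n k => or_introl (lp_d0 (pP n) k)) (fun n k => let: And5 _ h _ _ _ :=
    b n k in h).
have l4 n k := lp_lip4 (pP n) k.
have fwd_ok (F G : nat -> int -> R) (B : R) n k : 0 <= B -> F n (k + 1) - F n k = mesh R n * G n
    k ->
    `|F n (k + 1) - F n k - mesh R n * G n k| <= B * mesh R n ^+ 2.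
  by move=> B0 ->; rewrite subrr normr0 mulr_ge0 ?sqr_ge0.
have bwd_ok (F G : nat -> int -> R) n k : F n (k + 1) - F n k = mesh R n * G n (k + 1) ->
    `|G n (k + 1) - G n k| <= M * mesh R n ->
    `|F n (k + 1) - F n k - mesh R n * G n k| <= M * mesh R n ^+ 2.
  move=> -> GM; rewrite -mulrBr normrM gtr0_norm// [leRHS](_ : _ = mesh R n * (M * mesh R n));
      last by ring.
  by rewrite ler_pM2l.
have M0' := ltW M0.
exists (ul F0), (ul F1), (ul F2), (ul F3), (ul F4), (ul FJ), M, A; split.
- move=> x; split.
  + by apply: (limit_is_derive UU Uoo M0' _ _ c0 c1) => n k _; [apply: fwd_ok => //;
      exact: lp_d0 (pP n) k|exact: l1].
  + by apply: (limit_is_derive UU Uoo M0' _ _ c1 c2) => n k _; [apply: bwd_ok => //;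
      exact: lp_d1 (pP n) k|exact: l2].
  + by apply: (limit_is_derive UU Uoo M0' _ _ c2 c3) => n k _; [apply: fwd_ok => //;
      exact: lp_d2 (pP n) k|exact: l3].
  + by apply: (limit_is_derive UU Uoo M0' _ _ c3 c4) => n k _; [apply: bwd_ok => //;
      exact: lp_d3 (pP n) k|exact: l4].
- move=> x.
  have L1 : (F4 n (node n x) + mu * F2 n (node n x) + omega * F0 n (node n x)) @[n --> U]
      --> ul F4 x + mu * ul F2 x + omega * ul F0 x.
    apply: cvgD; last by apply: cvgM; [exact: cvg_cst|exact: c0].
    by apply: cvgD; [exact: c4|apply: cvgM; [exact: cvg_cst|exact: c2]].
  have L2 : (F4 n (node n x) + mu * F2 n (node n x) + omega * F0 n (node n x)) @[n --> U]
      --> ul F0 x ^+ 3.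
    have -> : (fun n => F4 n (node n x) + mu * F2 n (node n x) + omega * F0 n (node n x)) =
       (fun n => F0 n (node n x) ^+ 3) by apply/funext => n; exact: lp_eq (pP n) _.
    exact: cvg_pow (c0 x).
  exact: (cvg_unique _ L1 L2).
- have le_lim (F : nat -> int -> R) : (forall n k, `|F n k| <= M) -> forall x, `|ul F x| <= M.
    move=> FM x; have /cvg_norm := ulP F M FM x => /cvgr_to_le; apply.
    by apply: (filterS _ filterT) => n _.
  by move=> x; split; apply: le_lim => n k; case: (b n k).
- move=> f00.
  have : (F0 n (node n (0 : R)) ^+ 2) @[n --> U] --> (ul F0 0) ^+ 2.
    exact: cvg_pow (c0 0).
  move=> cF.
  have H : \forall n \near U, c / 2 <= F0 n (node n (0 : R)) ^+ 2.
    apply: (filterS _ filterT) => n _; rewrite /node mul0r floor0.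
    exact: lp_peak (pP n).
  have chalf : 0 < c / 2 by exact: divr_gt0.
  have := lt_le_trans chalf (cvgr_to_ge cF H); rewrite f00 expr2 mul0r ltxx. by move=> /(_ PU).
- move=> x; split; last first.
    have J0 : \forall n \near U, 0 <= FJ n (node n x).
      by apply: (filterS _ filterT) => n _; have /andP[] := lp_mass (pP n) (node n x).
    have JA : \forall n \near U, FJ n (node n x) <= A.
      by apply: (filterS _ filterT) => n _; have /andP[] := lp_mass (pP n) (node n x).
    by rewrite (cvgr_to_ge (cJ x) J0) (cvgr_to_le (cJ x) JA).
  (* The Lipschitz constant of f0^2 is twice that of f0 times its bound. *)
  pose G n k := F0 n k ^+ 2.
  have M2 : 0 <= 2 * M ^+ 2 by rewrite mulr_ge0 ?sqr_ge0.
  have cG y : G n (node n y) @[n --> U] --> (ul F0 y) ^+ 2.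
    exact: cvg_pow (c0 y).
  apply: (limit_is_derive UU Uoo M2 _ _ cJ cG) => n k kL.
    by apply: fwd_ok => //; exact: lp_dJ (pP n) k kL.
  rewrite /G subr_sqr normrM (_ : 2 * M ^+ 2 * mesh R n = (M * mesh R n) * (M + M)); last by ring.
  rewrite ler_pM// ?l0//; apply: (le_trans (ler_normD _ _)).
  by apply: lerD; case: (b n k); case: (b n (k + 1)).
Qed.
End LimitProfile.

(** * Monotonicity and growth *)

Section Monotone.
Variable R : realType.

Lemma le_of_derive_ge0 (F F' : R -> R) (x y : R) :
  (forall t : R, is_derive t 1 F (F' t)) ->
  (forall t, x <= t -> t <= y -> 0 <= F' t) -> x <= y -> F x <= F y.
Proof.
move=> dF F0 xy; apply: (@ger0_derive1_ndecr _ F x y) => //.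
- move=> t; rewrite in_itv/= => /andP[xt ty].
  by rewrite derive1E (@derive_val _ _ _ _ _ _ _ (dF t)) F0// ltW.
- apply: derivable_within_continuous => t _; exact: (@ex_derive _ _ _ _ _ _ _ (dF t)).
Qed.

Lemma is_derive_expRM (k x : R) : is_derive x 1 (fun t => expR (k * t)) (k * expR (k * x)).
Proof.
apply: is_derive_eq; rewrite /GRing.scale/= !mulr1; ring.
Qed.

Lemma is_derive_expR_comp (f : R -> R) (df x : R) :
  is_derive x 1 f df -> is_derive x 1 (fun t => expR (f t)) (df * expR (f x)).
Proof.
move=> fd; have ed := is_derive_expR (f x).
by rewrite mulrC; exact: (@is_derive1_comp R expR f x (expR (f x)) df ed fd).
Qed.

(** Otherwise exp (- a t) Y would stay above a positive constant from some point on, and Y would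
    be unbounded. *)
Lemma le0_of_exp_growth (Y Y' : R -> R) (a X B : R) : 0 < a ->
  (forall t : R, is_derive t 1 Y (Y' t)) ->
  (forall t, X <= t -> a * Y t <= Y' t) ->
  (forall t, X <= t -> Y t <= B) -> forall x, X <= x -> Y x <= 0.
Proof.
move=> a0 dY Ya YB x Xx; rewrite leNgt; apply/negP => Yx.
(* At x + t the lower bound Y x exp (a t) >= Y x (1 + a t) already exceeds B. *)
pose t := `|B| / (a * Y x).
have t0 : 0 <= t by rewrite divr_ge0// mulr_ge0 ?ltW.
have dE (z : R) : is_derive z 1 (fun z => expR (- a * z) * Y z) (expR (- a * z) * (Y' z - a * Y z)).
  have d1 := is_derive_expRM (- a) z; have d2 := dY z.
  by apply: is_derive_eq; rewrite /GRing.scale/=; ring.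
have : expR (- a * x) * Y x <= expR (- a * (x + t)) * Y (x + t).
  apply: (le_of_derive_ge0 dE); last by rewrite lerDl.
  move=> z xz _; rewrite mulr_ge0 ?expR_ge0// subr_ge0 Ya//; exact: le_trans xz.
rewrite mulrDr expRD -mulrA ler_pM2l ?expR_gt0// mulNr expRN mulrC.
rewrite ler_pdivlMr ?expR_gt0// => H.
have H1 : Y x * (1 + a * t) <= Y (x + t).
  by apply: le_trans H; rewrite ler_pM2l// expR_ge1Dx.
have H2 : Y (x + t) <= `|B|.
  by apply: le_trans (ler_norm B); apply: YB; rewrite (le_trans Xx)// lerDl.
have : Y x * (1 + a * t) = Y x + `|B|.
  by rewrite /t; field; rewrite !gt_eqF.
move=> E; rewrite E in H1; have := le_trans H1 H2; rewrite gerDr leNgt Yx//.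
Qed.

(** Barbalat's argument.  Where f^2 exceeds e it remains above e / 2 on an interval of fixed
    length r, on which J gains e r / 2; beyond a point where J is within e r / 2 of its supremum
    this is impossible. *)
Lemma vanishing_of_integrable (f f' J : R -> R) (M A : R) :
  (forall t : R, is_derive t 1 f (f' t)) -> (forall t : R, is_derive t 1 J (f t ^+ 2)) ->
  (forall t, `|f t| <= M) -> (forall t, `|f' t| <= M) -> (forall t, J t <= A) ->
  forall e, 0 < e -> exists X, forall x, X <= x -> f x ^+ 2 <= e.
Proof.
move=> df dJ fM f'M JA e e0.
(* L is a Lipschitz constant of f^2; adding 1 makes it positive. *)
pose L := 2 * M ^+ 2 + 1.
have L0 : 0 < L by rewrite ltr_wpDl// mulr_ge0 ?sqr_ge0.
pose r := e / (2 * L); have r0 : 0 < r by rewrite divr_gt0 ?mulr_gt0.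
have hs : has_sup (range J) by split; [exists (J 0), 0|exists A => _ [x _ <-]].
have [_ [x0 _ <-] Jx0] := sup_adherent (mulr_gt0 r0 (divr_gt0 e0 (@ltr0Sn R 1))) hs.
exists x0 => x x0x; rewrite leNgt; apply/negP => fxe.
have df2 (t : R) : is_derive t 1 (fun t => f t ^+ 2 + L * t) (2 * (f t * f' t) + L).
  have d := df t; apply: is_derive_eq; rewrite /GRing.scale/=. ring.
have fge t : x <= t -> t <= x + r -> e / 2 <= f t ^+ 2.
  move=> xt tr.
  have : f x ^+ 2 + L * x <= f t ^+ 2 + L * t.
    apply: (le_of_derive_ge0 df2) => // z _ _.
    have : `|f z * f' z| <= M * M by rewrite normrM ler_pM.
    rewrite ler_norml => /andP[+ _]; rewrite /L expr2; lra.
  have : L * (t - x) <= L * r by rewrite ler_pM2l// lerBlDl.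
  have -> : L * r = e / 2 by rewrite /r; field; rewrite gt_eqF.
  rewrite mulrBr; lra.
have dJ2 (t : R) : is_derive t 1 (fun t => J t - e / 2 * t) (f t ^+ 2 - e / 2).
  have d := dJ t; apply: is_derive_eq; rewrite /GRing.scale/=; ring.
have J1 : J x - e / 2 * x <= J (x + r) - e / 2 * (x + r).
  apply: (le_of_derive_ge0 dJ2); last by rewrite lerDl ltW.
  by move=> t xt tr; rewrite subr_ge0 fge.
have J2 : J x0 <= J x by apply: (le_of_derive_ge0 dJ) => // t _ _; exact: sqr_ge0.
have J3 : J (x + r) <= sup (range J) by apply: ub_le_sup; [exact: hs.2|exists (x + r)].
move: Jx0 J1 J2 J3; rewrite mulrDr; move: (sup _) (J x0) (J x) (J (x + r)) => *; lra.
Qed.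
End Monotone.

(** * Exponential decay at the sharp rate *)

(** With k2 = a^2 + b^2 the equation of [df3] is ((D - a)^2 + b^2) ((D + a)^2 + b^2) f0 = f0^3. *)
Section Decay.
Variables (R : realType) (a b : R).
Hypotheses (a_gt0 : 0 < a) (b_gt0 : 0 < b).
Let k2 := a ^+ 2 + b ^+ 2.
Variables f0 f1 f2 f3 : R -> R.
Hypothesis df0 : forall t : R, is_derive t 1 f0 (f1 t).
Hypothesis df1 : forall t : R, is_derive t 1 f1 (f2 t).
Hypothesis df2 : forall t : R, is_derive t 1 f2 (f3 t).
Hypothesis df3 : forall t : R,
  is_derive t 1 f3 (f0 t ^+ 3 - 2 * (b ^+ 2 - a ^+ 2) * f2 t - k2 ^+ 2 * f0 t).
Variable M : R.
Hypothesis fM : forall x, [/\ `|f0 x| <= M, `|f1 x| <= M, `|f2 x| <= M & `|f3 x| <= M].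
Hypothesis f0_vanish : forall e, 0 < e -> exists X, forall x, X <= x -> f0 x ^+ 2 <= e.

Let q t := f1 t + a * f0 t.
(** The result of applying (D + a)^2 + b^2 to f0; it annihilates the stable solutions.  So (f0, q)
    are coordinates on the stable plane and (w, s) on the unstable one. *)
Let w t := f2 t + 2 * a * f1 t + k2 * f0 t.
Let s t := f3 t + 2 * a * f2 t + k2 * f1 t - a * w t.
Let V t := q t ^+ 2 + b ^+ 2 * f0 t ^+ 2.
Let W t := s t ^+ 2 + b ^+ 2 * w t ^+ 2.

Let dq (t : R) : is_derive t 1 q (w t - a * q t - b ^+ 2 * f0 t).
Proof.
have d0 := df0 t; have d1 := df1 t.
by apply: is_derive_eq; rewrite /GRing.scale/= /w /q /k2; ring.
Qed.

Let dw (t : R) : is_derive t 1 w (s t + a * w t).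
Proof.
have d0 := df0 t; have d1 := df1 t; have d2 := df2 t.
by apply: is_derive_eq; rewrite /GRing.scale/= /s; ring.
Qed.

Let ds (t : R) : is_derive t 1 s (f0 t ^+ 3 - b ^+ 2 * w t + a * s t).
Proof.
have d1 := df1 t; have d2 := df2 t; have d3 := df3 t; have d4 := dw t.
by apply: is_derive_eq; rewrite /GRing.scale/= /s /w /k2; ring.
Qed.

Let dV (t : R) : is_derive t 1 V (- 2 * a * V t + 2 * q t * w t).
Proof.
have d0 := df0 t; have d1 := dq t.
apply: is_derive_eq; rewrite /GRing.scale/=.
rewrite (_ : f1 t = q t - a * f0 t); last by rewrite /q; ring.
rewrite /V; ring.
Qed.

Let dW (t : R) : is_derive t 1 W (2 * a * W t + 2 * s t * f0 t ^+ 3).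
Proof.
have d0 := dw t; have d1 := ds t.
by apply: is_derive_eq; rewrite /GRing.scale/= /W; ring.
Qed.

Let V0 t : 0 <= V t.
Proof. by apply: addr_ge0; [|apply: mulr_ge0]; exact: sqr_ge0. Qed.
Let W0 t : 0 <= W t.
Proof. by apply: addr_ge0; [|apply: mulr_ge0]; exact: sqr_ge0. Qed.

Let bounded_VW : exists B, forall x, V x <= B /\ W x <= B.
Proof.
have M0 : 0 <= M by have [+ _ _ _] := fM 0; apply: le_trans.
have k20 : 0 <= k2 by rewrite addr_ge0 ?sqr_ge0.
have sqN (x K : R) : `|x| <= K -> x ^+ 2 <= K ^+ 2.
  by move=> xK; rewrite -real_normK ?num_real// lerXn2r// nnegrE// (le_trans _ xK).
pose Kw := M + 2 * a * M + k2 * M.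
pose Ks := M + 2 * a * M + k2 * M + a * Kw.
have wK x : `|w x| <= Kw.
  have [h0 h1 h2 h3] := fM x; apply: (le_trans (ler_normD _ _)); apply: lerD; last first.
    by rewrite normrM ger0_norm// ler_wpM2l.
  apply: (le_trans (ler_normD _ _)); apply: lerD => //.
  by rewrite normrM ger0_norm ?mulr_ge0 ?(ltW a_gt0)// ler_wpM2l// mulr_ge0// ltW.
have sK x : `|s x| <= Ks.
  have [h0 h1 h2 h3] := fM x; apply: (le_trans (ler_normB _ _)); apply: lerD; last first.
    by rewrite normrM gtr0_norm// ler_pM2l.
  apply: (le_trans (ler_normD _ _)); apply: lerD; last first.
    by rewrite normrM ger0_norm// ler_wpM2l.
  apply: (le_trans (ler_normD _ _)); apply: lerD => //.
  by rewrite normrM ger0_norm ?mulr_ge0 ?(ltW a_gt0)// ler_wpM2l// mulr_ge0// ltW.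
have qK x : `|q x| <= M + a * M.
  have [h0 h1 h2 h3] := fM x; apply: (le_trans (ler_normD _ _)); apply: lerD => //.
  by rewrite normrM gtr0_norm// ler_pM2l.
exists ((M + a * M) ^+ 2 + b ^+ 2 * M ^+ 2 + (Ks ^+ 2 + b ^+ 2 * Kw ^+ 2)) => x.
have [h0 _ _ _] := fM x.
have v : V x <= (M + a * M) ^+ 2 + b ^+ 2 * M ^+ 2.
  by apply: lerD; [exact: sqN|rewrite ler_wpM2l ?sqr_ge0//; exact: sqN].
have ww : W x <= Ks ^+ 2 + b ^+ 2 * Kw ^+ 2.
  by apply: lerD; [exact: sqN|rewrite ler_wpM2l ?sqr_ge0//; exact: sqN].
have := V0 x; have := W0 x; lra.
Qed.

Let young (k x y : R) : 0 < k -> 2 * x * y <= k * x ^+ 2 + y ^+ 2 / k.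
Proof.
move=> k0; rewrite -subr_ge0.
rewrite (_ : _ - _ = (k * x - y) ^+ 2 / k); last by field; rewrite gt_eqF.
by rewrite divr_ge0 ?sqr_ge0// ltW.
Qed.

(** The slope of the cone.  It makes the coupling term 2 q w at most a V inside the cone, half of
    the linear contraction 2 a V. *)
Let kap := a * b / 2.
Let kap_gt0 : 0 < kap. Proof. by rewrite divr_gt0 ?mulr_gt0. Qed.

(** Once f0 is small, W - kap^2 V grows at least at the rate a; it is bounded, hence never
    positive. *)
Let cone : exists X, forall x, X <= x -> W x <= kap ^+ 2 * V x.
Proof.
(* The two entries of the minimum let f0^3 be absorbed by W and by V respectively. *)
pose d := Num.min (a / 2) (a * kap ^+ 2 * b ^+ 2 / 2).
have d0 : 0 < d by rewrite lt_min !divr_gt0 ?mulr_gt0 ?exprn_gt0.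
have d1 : d <= a / 2 by rewrite ge_min lexx.
have d2 : d <= a * kap ^+ 2 * b ^+ 2 / 2 by rewrite ge_min lexx orbT.
have [B VWB] := bounded_VW.
have [X fX] := f0_vanish d0; exists X => x Xx; rewrite -subr_le0.
have dY (t : R) : is_derive t 1 (fun t => W t - kap ^+ 2 * V t)
    ((2 * a * W t + 2 * s t * f0 t ^+ 3) - kap ^+ 2 * (- 2 * a * V t + 2 * q t * w t)).
  by have e1 := dV t; have e2 := dW t; apply: is_derive_eq.
apply: (le0_of_exp_growth (B := B) a_gt0 dY _ _ Xx) => t Xt; last first.
  have [_ WB] := VWB t; have := V0 t; have := sqr_ge0 kap => h1 h2.
  have := mulr_ge0 h1 h2; lra.
have fd := fX _ Xt.
have E1 : - (2 * s t * f0 t ^+ 3) <= d * s t ^+ 2 + d * f0 t ^+ 2.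
  have u : - (2 * s t * f0 t) <= s t ^+ 2 + f0 t ^+ 2.
    have := sqr_ge0 (s t + f0 t); rewrite sqrrD -mulr_natl; lra.
  rewrite (_ : - _ = f0 t ^+ 2 * - (2 * s t * f0 t)); last by ring.
  rewrite -mulrDr; apply: (le_trans (ler_wpM2l (sqr_ge0 _) u)).
  by rewrite ler_wpM2r// addr_ge0 ?sqr_ge0.
have E2 : kap ^+ 2 * (2 * q t * w t) <= a / 2 * (kap ^+ 2 * V t + W t).
  have := young (q t) (b * w t) kap_gt0; set y := _ / kap => yg.
  apply: (@le_trans _ _ (kap ^+ 2 / b * (kap * q t ^+ 2 + y))).
    rewrite (_ : kap ^+ 2 * _ = kap ^+ 2 / b * (2 * q t * (b * w t))); last by field;
        rewrite gt_eqF.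
    by rewrite ler_wpM2l// divr_ge0 ?sqr_ge0// ltW.
  rewrite [leLHS](_ : _ = a / 2 * (kap ^+ 2 * q t ^+ 2 + b ^+ 2 * w t ^+ 2)); last first.
    by rewrite /y /kap; field; rewrite !gt_eqF.
  rewrite ler_pM2l ?divr_gt0//; apply: lerD; last by rewrite lerDr sqr_ge0.
  by rewrite ler_wpM2l ?sqr_ge0// lerDl mulr_ge0 ?sqr_ge0.
have E3 : d * s t ^+ 2 <= a / 2 * W t.
  apply: ler_pM; rewrite ?sqr_ge0 ?(ltW d0)//.
  by rewrite lerDl mulr_ge0 ?sqr_ge0.
have E4 : d * f0 t ^+ 2 <= a / 2 * (kap ^+ 2 * V t).
  apply: (@le_trans _ _ (a * kap ^+ 2 * b ^+ 2 / 2 * f0 t ^+ 2)).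
    by rewrite ler_wpM2r ?sqr_ge0.
  rewrite [leLHS](_ : _ = a / 2 * (kap ^+ 2 * (b ^+ 2 * f0 t ^+ 2))); last by ring.
  by rewrite ler_pM2l ?divr_gt0// ler_pM2l ?exprn_gt0// lerDr sqr_ge0.
have E5 : 0 <= a * (kap ^+ 2 * V t) by rewrite mulr_ge0 ?(ltW a_gt0)// mulr_ge0 ?sqr_ge0.
rewrite [leRHS](_ : _ = 2 * (a * W t) + 2 * s t * f0 t ^+ 3
  + 2 * (a * (kap ^+ 2 * V t)) - kap ^+ 2 * (2 * q t * w t)); last by ring.
rewrite (mulrDr (a / 2)) in E2; move: E1 E2 E3 E4 E5.
rewrite mulrBr; move: (kap ^+ 2 * (2 * q t * w t)) (2 * s t * f0 t ^+ 3) (d * s t ^+ 2) (d * f0 t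
    ^+ 2).
move: (kap ^+ 2 * V t) (W t) => p1 p2 p3 p4 p5 p6; lra.
Qed.

(** In the cone the coupling costs half of the contraction rate 2 a of V. *)
Let first_rate : exists X K, 0 <= K /\ forall x, X <= x -> V x <= K * expR (- a * x).
Proof.
have [X cX] := cone; exists X, (V X / expR (- a * X)).
split; first by rewrite divr_ge0 ?expR_ge0.
move=> x Xx.
(* Only functions that increase are covered by [le_of_derive_ge0], whence the sign. *)
have dE (t : R) : is_derive t 1 (fun t => - (expR (a * t) * V t))
    (- (expR (a * t) * (- a * V t + 2 * q t * w t))).
  have e1 := dV t; have e2 := is_derive_expRM a t.
  by apply: is_derive_eq; rewrite /GRing.scale/=; ring.
have : - (expR (a * X) * V X) <= - (expR (a * x) * V x).
  apply: (le_of_derive_ge0 dE) => // t Xt _.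
  rewrite oppr_ge0 mulr_ge0_le0 ?expR_ge0//.
  have := young (q t) (b * w t) kap_gt0; set y := _ / kap => yg.
  have y1 : y <= kap * V t.
    rewrite /y ler_pdivrMr// mulrAC -expr2; apply: le_trans (cX _ Xt).
    by rewrite exprMn lerDr sqr_ge0.
  have y2 : kap * q t ^+ 2 <= kap * V t.
    by rewrite ler_pM2l// lerDl mulr_ge0 ?sqr_ge0.
  rewrite (_ : 2 * q t * w t = (2 * q t * (b * w t)) / b); last by field; rewrite gt_eqF.
  suff : 2 * q t * (b * w t) / b <= a * V t by lra.
  rewrite ler_pdivrMr//; have : 2 * (kap * V t) = a * V t * b by rewrite /kap; field.
  lra.
rewrite lerN2 mulNr expRN invrK mulNr expRN => H.
by rewrite ler_pdivlMr ?expR_gt0// mulrC (mulrC (V X)).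
Qed.

(** The square of f0^3 is O(V^3) = O(exp (- 3 a x)).  A particular multiple of exp (- 3 a x) is a
    supersolution for W, and the difference would otherwise grow exponentially. *)
Let second_rate : exists X C, 0 <= C /\ forall x, X <= x -> W x <= C * expR (- (3 * a) * x).
Proof.
have [X [K [K0 VK]]] := first_rate; have [B VWB] := bounded_VW.
pose C := K ^+ 3 / (a * b ^+ 6).
have C0 : 0 <= C by rewrite divr_ge0 ?exprn_ge0// ltW// mulr_gt0 ?exprn_gt0.
(* With rate 3 a against the growth rate a, the supersolution needs the factor 1 / (3 a + a). *)
exists X, (C / (4 * a)); split; first by rewrite divr_ge0// mulr_ge0// ltW.
move=> x Xx; rewrite -subr_le0.
have dY (t : R) : is_derive t 1 (fun t => W t - C / (4 * a) * expR (- (3 * a) * t))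
    ((2 * a * W t + 2 * s t * f0 t ^+ 3) + 3 / 4 * C * expR (- (3 * a) * t)).
  have e1 := is_derive_expRM (- (3 * a)) t; have e2 := dW t.
  by apply: is_derive_eq; rewrite /GRing.scale/=; field; rewrite gt_eqF.
apply: (le0_of_exp_growth (B := B) a_gt0 dY _ _ Xx) => t Xt; last first.
  have [_ WB] := VWB t.
  have : 0 <= C / (4 * a) * expR (- (3 * a) * t).
    by rewrite mulr_ge0 ?expR_ge0// divr_ge0// mulr_ge0// ltW.
  lra.
have f6 : (f0 t ^+ 3) ^+ 2 / a <= C * expR (- (3 * a) * t).
  have p2 : b ^+ 2 * f0 t ^+ 2 <= K * expR (- a * t).
    by apply: le_trans (VK _ Xt); rewrite lerDr sqr_ge0.
  have : (b ^+ 2 * f0 t ^+ 2) ^+ 3 <= (K * expR (- a * t)) ^+ 3.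
    have p0 : 0 <= b ^+ 2 * f0 t ^+ 2 by apply: mulr_ge0; exact: sqr_ge0.
    by rewrite lerXn2r ?nnegrE//; exact: le_trans p2.
  rewrite (_ : - (3 * a) * t = 3%:R * (- a * t)); last by ring.
  rewrite expRM_natl; move: (expR _) => E.
  rewrite [leLHS](_ : _ = b ^+ 6 * (f0 t ^+ 3) ^+ 2); last by ring.
  rewrite [leRHS](_ : _ = K ^+ 3 * E ^+ 3); last by ring.
  move=> H; rewrite /C [leRHS](_ : _ = (K ^+ 3 * E ^+ 3) / b ^+ 6 / a); last first.
    by field; rewrite !gt_eqF.
  by rewrite ler_pM2r ?invr_gt0// ler_pdivlMr ?exprn_gt0// mulrC.
have := young (- s t) (f0 t ^+ 3) a_gt0; rewrite sqrrN => yg.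
have sW : a * s t ^+ 2 <= a * W t by rewrite ler_pM2l// lerDl mulr_ge0 ?sqr_ge0.
rewrite mulrBr (_ : a * (C / _ * _) = C * expR (- (3 * a) * t) / 4); last by field; rewrite gt_eqF.
rewrite -(mulrA (3 / 4) C).
move: f6 yg sW; move: (_ / a) (C * expR _) => u v f6 yg sW; lra.
Qed.

(** Z = exp (2 a x) V would be constant if w vanished.  The coupling makes it grow by at most
    (1 + C2) g (1 + Z) with g = exp (- a x / 2) integrable, whence a Gronwall factor N that
    stays bounded. *)
Let final_rate : exists C, 0 <= C /\ forall x,
  V x <= C * expR (- (2 * a) * x) /\ W x <= C * expR (- (2 * a) * x).
Proof.
have [X [C [C0 CW]]] := second_rate; have [B VWB] := bounded_VW.
have B0 : 0 <= B by have [+ _] := VWB 0; apply: le_trans.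
pose C2 := C / b ^+ 2.
have C20 : 0 <= C2 by rewrite divr_ge0 ?exprn_ge0// ltW.
pose g t := expR (- (a / 2) * t).
pose Z t := expR (2 * a * t) * V t.
pose N t := (1 + Z t) * expR (2 / a * (1 + C2) * g t).
have gE t : expR (- (3 * a) * t) * expR (2 * a * t) = g t ^+ 2.
  by rewrite /g -expRM_natl -expRD; congr expR; field.
(* - (2 / a) g is a primitive of g. *)
have dN (t : R) : is_derive t 1 (fun t => - N t)
   (- (expR (2 / a * (1 + C2) * g t) *
       (expR (2 * a * t) * (2 * q t * w t) - (1 + C2) * g t * (1 + Z t)))).
  have e1 := dV t; have e2 := is_derive_expRM (2 * a) t.
  have e3 : is_derive t 1 (fun t => 2 / a * (1 + C2) * g t) (- (1 + C2) * g t).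
    have e4 := is_derive_expRM (- (a / 2)) t.
    by apply: is_derive_eq; rewrite /GRing.scale/= /g; field; rewrite gt_eqF.
  have e5 := is_derive_expR_comp e3.
  by apply: is_derive_eq; rewrite /GRing.scale/= /Z; ring.
have N_le x : X <= x -> 1 + Z x <= N X.
  move=> Xx; have Z0 t : 0 <= Z t by rewrite mulr_ge0 ?expR_ge0.
  apply: (@le_trans _ _ (N x)).
    rewrite /N ler_peMr ?addr_ge0//; apply: le_trans (expR_ge1Dx _).
    by rewrite lerDl mulr_ge0 ?expR_ge0// mulr_ge0 ?addr_ge0// divr_ge0// ltW.
  rewrite -lerN2; apply: (le_of_derive_ge0 dN) => // t Xt _.
  rewrite oppr_ge0 mulr_ge0_le0 ?expR_ge0// subr_le0.
  have g0 : 0 < g t by exact: expR_gt0.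
  have := young (q t) (w t) g0; set y := _ / g t => yg.
  have w2 : w t ^+ 2 <= C2 * expR (- (3 * a) * t).
    rewrite /C2 mulrAC ler_pdivlMr ?exprn_gt0// mulrC; apply: le_trans (CW _ Xt).
    by rewrite lerDr sqr_ge0.
  have E1 : expR (2 * a * t) * y <= C2 * g t.
    rewrite /y mulrA ler_pdivrMr// [leRHS](_ : _ = C2 * g t ^+ 2); last by ring.
    rewrite -gE (mulrC (expR (2 * a * t)) (w t ^+ 2)) mulrA.
    by rewrite ler_wpM2r ?expR_ge0.
  have E2 : expR (2 * a * t) * (g t * q t ^+ 2) <= g t * Z t.
    by rewrite mulrCA ler_pM2l// ler_wpM2l ?expR_ge0// lerDl mulr_ge0 ?sqr_ge0.
  have E3 : expR (2 * a * t) * (2 * q t * w t) <= expR (2 * a * t) * (g t * q t ^+ 2 + y).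
    by rewrite ler_wpM2l ?expR_ge0.
  have E4 : 0 <= C2 * (g t * Z t) by rewrite mulr_ge0// mulr_ge0// ltW.
  rewrite (mulrDr (expR (2 * a * t)) (g t * q t ^+ 2) y) in E3.
  rewrite [leRHS](_ : _ = g t + g t * Z t + C2 * g t + C2 * (g t * Z t)); last by ring.
  move: (expR (2 * a * t) * (2 * q t * w t)) (expR (2 * a * t) * y) (expR (2 * a * t) * (g t * q
      t ^+ 2)) E1 E2 E3 => x1 x2 x3 E1 E2 E3.
  move: (C2 * (g t * Z t)) (C2 * g t) (g t * Z t) E1 E2 E4 => x4 x5 x6 E1 E2 E4; lra.
have N0 : 0 <= N X.
  by apply: le_trans (N_le X (lexx _)); rewrite addr_ge0// mulr_ge0 ?expR_ge0.
have EX : expR (2 * a * X) * expR (- (2 * a) * X) = 1 by rewrite -expRD mulNr subrr expR0.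
exists (N X + B * expR (2 * a * X) + C * expR (- a * X)); split.
  by rewrite !addr_ge0// mulr_ge0 ?expR_ge0.
move=> x; have e0 := expR_ge0 (- (2 * a) * x).
have T1 := mulr_ge0 N0 e0.
have T2 : 0 <= B * expR (2 * a * X) * expR (- (2 * a) * x) by rewrite !mulr_ge0 ?expR_ge0.
have T3 : 0 <= C * expR (- a * X) * expR (- (2 * a) * x) by rewrite !mulr_ge0 ?expR_ge0.
rewrite !(mulrDl _ _ (expR (- (2 * a) * x))); have [Xx|xX] := leP X x.
  split.
    suff : V x <= N X * expR (- (2 * a) * x) by lra.
    rewrite mulNr expRN ler_pdivlMr ?expR_gt0// mulrC.
    by have := N_le _ Xx; rewrite /Z; lra.
  suff : W x <= C * expR (- a * X) * expR (- (2 * a) * x) by lra.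
  apply: (le_trans (CW _ Xx)); rewrite -mulrA ler_wpM2l//.
  rewrite -expRD ler_expR.
  have : a * X <= a * x by rewrite ler_pM2l.
  lra.
have T4 : B <= B * expR (2 * a * X) * expR (- (2 * a) * x).
  rewrite -mulrA ler_peMr// -expRD; apply: le_trans (expR_ge1Dx _).
  have : a * x <= a * X by rewrite ler_pM2l// ltW.
  lra.
have [v ww] := VWB x; split; lra.
Qed.

Lemma half_line_decay : exists C, 0 <= C /\ forall x,
  [/\ f0 x ^+ 2 <= C * expR (- (2 * a) * x), f1 x ^+ 2 <= C * expR (- (2 * a) * x),
     f2 x ^+ 2 <= C * expR (- (2 * a) * x) & f3 x ^+ 2 <= C * expR (- (2 * a) * x)].
Proof.
(* f0, ..., f3 are linear combinations of f0, q, w, s, all of which are in the linear space of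
   functions dominated by exp (- a x). *)
pose dec (f : R -> R) := exists C, 0 <= C /\ forall x, f x ^+ 2 <= C * expR (- (2 * a) * x).
have decD f g : dec f -> dec g -> dec (fun x => f x + g x).
  move=> [C [C0 fC]] [D [D0 gD]]; exists (2 * C + 2 * D); split;
      first by rewrite addr_ge0// mulr_ge0.
  move=> x; have := fC x; have := gD x; have := sqr_ge0 (f x - g x) => h1 h2 h3.
  rewrite [leRHS](_ : _ = 2 * (C * expR (- (2 * a) * x)) + 2 * (D * expR (- (2 * a) * x)));
      last by ring.
  rewrite (_ : (f x + g x) ^+ 2 = 2 * f x ^+ 2 + 2 * g x ^+ 2 - (f x - g x) ^+ 2); last by ring.
  lra.
have decZ k f : dec f -> dec (fun x => k * f x).
  move=> [C [C0 fC]]; exists (k ^+ 2 * C); split; first by rewrite mulr_ge0 ?sqr_ge0.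
  by move=> x; rewrite exprMn -(mulrA _ C) ler_wpM2l ?sqr_ge0.
have dec_eq f g : f =1 g -> dec f -> dec g by move=> /funext ->.
have [C [C0 VW]] := final_rate.
have Cb0 : 0 <= C / b ^+ 2 by rewrite divr_ge0 ?sqr_ge0.
have dec0 : dec f0.
  exists (C / b ^+ 2); split => // x; rewrite mulrAC ler_pdivlMr ?exprn_gt0// mulrC.
  by have [+ _] := VW x; apply: le_trans; rewrite lerDr sqr_ge0.
have decw : dec w.
  exists (C / b ^+ 2); split => // x; rewrite mulrAC ler_pdivlMr ?exprn_gt0// mulrC.
  by have [_] := VW x; apply: le_trans; rewrite lerDr sqr_ge0.
have decq : dec q.
  exists C; split => // x; have [+ _] := VW x; apply: le_trans.
  by rewrite lerDl mulr_ge0 ?sqr_ge0.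
have decs : dec s.
  exists C; split => // x; have [_] := VW x; apply: le_trans.
  by rewrite lerDl mulr_ge0 ?sqr_ge0.
have dec1 : dec f1.
  by apply: dec_eq (decD _ _ decq (decZ (- a) _ dec0)) => x; rewrite /q; ring.
have dec2 : dec f2.
  apply: dec_eq (decD _ _ decw (decD _ _ (decZ (- (2 * a)) _ dec1) (decZ (- k2) _ dec0))) => x.
  by rewrite /w; ring.
have dec3 : dec f3.
  apply: dec_eq (decD _ _ decs (decD _ _ (decZ a _ decw) (decD _ _ (decZ (- (2 * a)) _ dec2)
      (decZ (- k2) _ dec1)))) => x.
  by rewrite /s; ring.
have [D0 [D00 D0P]] := dec0; have [D1 [D10 D1P]] := dec1.
have [D2 [D20 D2P]] := dec2; have [D3 [D30 D3P]] := dec3.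
exists (D0 + D1 + D2 + D3); split; first by rewrite !addr_ge0.
move=> x; have e0 := expR_ge0 (- (2 * a) * x).
by split; [apply: le_trans (D0P x) _|apply: le_trans (D1P x) _|apply: le_trans (D2P x) _|
  apply: le_trans (D3P x) _]; rewrite ler_wpM2r//; lra.
Qed.

End Decay.

(** * Smooth decaying functions lie in every Sobolev space *)

Section Integration.
Variable R : realType.
Local Notation mu := (@lebesgue_measure R).

Lemma integral_expR_norm_lty (k : R) : 0 < k ->
  (\int[mu]_x (k * expR (- k * `|x|))%:E < +oo)%E.
Proof.
move=> k0; pose f (x : R) := k * expR (- k * `|x|).
have fc : continuous f.
  move=> x; apply: cvgM; first exact: cvg_cst.
  apply: (continuous_comp (f := fun x => - k * `|x|) (g := @expR R)); last exact: continuous_expR.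
  by apply: cvgM; [exact: cvg_cst|exact: norm_continuous].
rewrite (@ge0_symfun_integralT R f) //; last 2 first.
- by move=> x; rewrite mulr_ge0 ?expR_ge0// ltW.
- by move=> x; rewrite /f /= normrN.
rewrite integral_mkcond (_ : (_ \_ _)%E = (fun x => (exponential_pdf k x)%:E)).
  by rewrite integral_exponential_pdf// mule1 ltry.
apply/funext => x; rewrite /exponential_pdf !patchE /=.
have -> : (x \in [set x | 0 <= x]) = (x \in `[0, +oo[%classic) by rewrite set_itvcy.
by case: ifPn => //; rewrite inE/= in_itv/= andbT => x0; rewrite /f ger0_norm.
Qed.

(** The square of f is dominated by a multiple of the density of a two-sided exponential law. *)
Lemma Lfun2_of_exp_decay (f : R -> R) (C k : R) : 0 < k -> continuous f ->
  (forall x, `|f x| <= C * expR (- k * `|x|)) -> f \in Lfun mu 2%:E.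
Proof.
move=> k0 fc fC.
have C0 : 0 <= C.
  by have := fC 0; rewrite normr0 mulr0 expR0 mulr1; apply: le_trans.
have mf : measurable_fun setT f by exact: continuous_measurable_fun.
rewrite inE; apply/andP; split; first by rewrite inE.
rewrite inE/= /finite_norm unlock /=; apply: poweR_lty.
pose g (x : R) := (2 * k) * expR (- (2 * k) * `|x|).
have gc : continuous g.
  move=> x; apply: cvgM; first exact: cvg_cst.
  apply: (continuous_comp (f := fun x => - (2 * k) * `|x|) (g := @expR R));
      last exact: continuous_expR.
  by apply: cvgM; [exact: cvg_cst|exact: norm_continuous].
have mg : measurable_fun setT g by exact: continuous_measurable_fun.
have D0 : 0 <= C ^+ 2 / (2 * k) by rewrite divr_ge0 ?sqr_ge0// mulr_ge0// ltW.
have g0 x : 0 <= g x by rewrite mulr_ge0 ?expR_ge0// mulr_ge0// ltW.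
apply: (@le_lt_trans _ _ (\int[mu]_x ((C ^+ 2 / (2 * k))%:E * (g x)%:E))%E); last first.
  rewrite ge0_integralZl//.
  - by apply: lte_mul_pinfty => //; apply: integral_expR_norm_lty; rewrite mulr_gt0.
  - exact/measurable_EFinP.
  - by move=> x _; rewrite lee_fin.
apply: ge0_le_integral => //.
- apply/measurable_EFinP.
  apply/(@measurableT_comp _ _ _ _ _ _ (fun x : R => x `^ 2)%R) => //.
  exact/measurableT_comp.
- apply/measurable_EFinP; exact: measurable_funM.
- move=> x _; rewrite /= lee_fin powR_mulrn//.
  have -> : C ^+ 2 / (2 * k) * g x = (C * expR (- k * `|x|)) ^+ 2.
    rewrite exprMn -expRM_natl /g (_ : - (2 * k) * `|x| = 2%:R * (- k * `|x|)); last by ring.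
    by field; rewrite gt_eqF.
  by rewrite lerXn2r ?nnegrE// mulr_ge0 ?expR_ge0.
Qed.

Lemma derivable_derivable_oo_LRcontinuous (f : R -> R) (x y : R) : (forall t : R, derivable f t
    1) ->
  derivable_oo_LRcontinuous f x y.
Proof.
move=> df.
have cf : continuous f by move=> t; exact/differentiable_continuous/derivable1_diffP.
split => [t _||]; first exact: df.
- by apply: cvg_at_right_filter; exact: cf.
- by apply: cvg_at_left_filter; exact: cf.
Qed.

Lemma Rintegral_compact_support (f : R -> R) (r : R) :
  (forall x, r < `|x| -> f x = 0) -> \int[mu]_x f x = \int[mu]_(x in `[- r, r]) f x.
Proof.
move=> f0; rewrite [in RHS]Rintegral_mkcond; congr Rintegral; apply/funext => x.
rewrite patchE; case: ifPn => //; rewrite notin_setE/= in_itv/= => /negP.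
by rewrite -ler_norml -ltNge => /f0.
Qed.

Lemma integration_by_parts_compact (f g : R -> R) (r : R) : 0 < r ->
  (forall t : R, derivable f t 1) -> continuous (derive1 f) ->
  (forall t : R, derivable g t 1) -> continuous (derive1 g) ->
  (forall x, r <= `|x| -> g x = 0) -> (forall x, r <= `|x| -> (derive1 g) x = 0) ->
  \int[mu]_x (f x * (derive1 g) x) = - \int[mu]_x ((derive1 f) x * g x).
Proof.
move=> r0 df cf dg cg g0 g'0.
rewrite (@Rintegral_compact_support _ r); last by move=> x rx; rewrite g'0 ?mulr0// ltW.
rewrite (@Rintegral_compact_support (fun x => (derive1 f) x * g x) r); last first.
  by move=> x rx; rewrite g0 ?mulr0// ltW.
have cf' : {within `[- r, r], continuous (derive1 f)} := continuous_subspaceT cf.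
have cg' : {within `[- r, r], continuous (derive1 g)} := continuous_subspaceT cg.
have rr : - r < r by rewrite gtrN.
have -> := Rintegration_by_parts rr cf' (derivable_derivable_oo_LRcontinuous (- r) r df) (fun _ _
    => erefl)
  cg' (derivable_derivable_oo_LRcontinuous (- r) r dg) (fun _ _ => erefl).
by rewrite !g0 ?normrN ?ler_norm// !mulr0 subrr sub0r.
Qed.

Lemma derive1n_vanish (psi : R -> R) (r : R) : (forall x, r < `|x| -> psi x = 0) ->
  forall k x, r < `|x| -> derive1n k psi x = 0.
Proof.
move=> p0; elim=> [//|k IH] x rx; rewrite derive1nS derive1E.
rewrite (@near_eq_derive _ _ _ _ (cst 0)) ?derive_cst//.
have : \forall y \near x, r < `|y|.
  have : nbhs `|x| [set z | r < z] by exact: lt_nbhsr.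
  exact: norm_continuous.
by apply: filterS => y; exact: IH.
Qed.

(** Working with a class that is stable under differentiation avoids formulas for the higher
    derivatives of the solution; the class used for it is [generated]. *)
Section DecayClass.
Variables (A : (R -> R) -> Prop) (k : R).
Hypothesis k_gt0 : 0 < k.
Hypothesis A_derivable : forall f, A f -> forall t : R, derivable f t 1.
Hypothesis A_derive : forall f, A f -> A (derive1 f).
Hypothesis A_decay : forall f, A f -> exists C, forall x, `|f x| <= C * expR (- k * `|x|).

Let A_continuous f : A f -> continuous f.
Proof. by move=> /A_derivable df t; exact/differentiable_continuous/derivable1_diffP. Qed.

Let A_deriven n f : A f -> A (derive1n n f).
Proof. by move=> Af; elim: n => [//|n IH]; rewrite derive1nS; exact: A_derive. Qed.

Lemma decay_class_Ck n f : A f -> Ck n f.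
Proof.
by move=> Af; split => j _; [apply: A_derivable|apply: A_continuous]; exact: A_deriven.
Qed.

Lemma decay_class_Lfun2 f : A f -> f \in Lfun mu 2%:E.
Proof.
move=> Af; have [C fC] := A_decay Af.
exact: (Lfun2_of_exp_decay k_gt0 (A_continuous Af) fC).
Qed.

(** One integration by parts for each derivative, the boundary terms being killed by the compact
    support of the test function. *)
Lemma decay_class_weak_derivative j f : A f -> weak_derivative j f (derive1n j f).
Proof.
move=> Af psi [pC] /compact_bounded [B [_ bB]].
(* The margin of 1 between the support and r lets the closed condition r <= |x| be used. *)
pose r := `|B| + 2.
have r0 : 0 < r by rewrite ltr_wpDl.
have p0 : forall x, r - 1 < `|x| -> psi x = 0.
  move=> x rx; apply/eqP; apply: contraT => px.
  have : `|x| <= `|B| + 1.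
    apply: (bB (`|B| + 1)); first by rewrite ltr_pwDr// ler_norm.
    exact: subset_closure.
  by rewrite leNgt; move: rx; rewrite /r -addrA (_ : 2 - 1 = 1 :> R) => [->|]; lra.
have pj0 i x : r <= `|x| -> derive1n i psi x = 0.
  by move=> rx; apply: (derive1n_vanish p0); apply: lt_le_trans rx; rewrite ltrBlDr ltrDl.
elim: j f Af => [|j IH] f Af; first by rewrite expr0 mul1r.
have [dp cp] := pC j.+2.
rewrite derive1nS (integration_by_parts_compact r0).
- have -> : derive1n j.+1 f = derive1n j (derive1 f) by rewrite /derive1n -iterSr.
  by rewrite (IH _ (A_derive Af)) exprS mulN1r mulNr.
- exact: A_derivable.
- exact/A_continuous/A_derive.
- exact: dp.
- exact: (cp j.+1).
- exact: pj0.
- by move=> x rx; exact: (pj0 j.+1).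
Qed.

Lemma decay_class_Sobolev f : A f -> Sobolev_infty f.
Proof.
move=> Af j; split; first exact: decay_class_Lfun2.
move=> i _; exists (derive1n i f); split; last exact: decay_class_weak_derivative.
exact/decay_class_Lfun2/A_deriven.
Qed.
End DecayClass.
End Integration.

(** * The solitary wave *)

(** With o = sqrt omega, the fraction th = mu / (2 o) < 1 of s^2 + o^2 t^2 absorbs mu t s, by
    completing the square (s + o t)^2; the remaining fraction is the coercivity constant. *)
Lemma coercive_symbol (R : realType) (omega mu : R) : 0 < omega -> 0 < mu ->
  mu < 2 * Num.sqrt omega ->
  exists c, 0 < c /\ forall s t : R,
    c * (s ^+ 2 + t ^+ 2) <= s ^+ 2 + mu * (t * s) + omega * t ^+ 2.
Proof.
move=> o0 m0 mo; set o := Num.sqrt omega in mo.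
have o_gt0 : 0 < o by rewrite sqrtr_gt0.
have oE : omega = o ^+ 2 by rewrite sqr_sqrtr// ltW.
pose th := mu / (2 * o).
have th1 : th < 1 by rewrite ltr_pdivrMr ?mulr_gt0// mul1r.
have th0 : 0 < th by rewrite divr_gt0// mulr_gt0.
pose m := Num.min 1 omega.
have m_gt0 : 0 < m by rewrite lt_min ltr01.
have m1 : m <= 1 by rewrite ge_min lexx.
have mom : m <= omega by rewrite ge_min lexx orbT.
exists ((1 - th) * m); split; first by rewrite mulr_gt0// subr_gt0.
move=> s t.
have -> : mu = th * (2 * o) by rewrite /th; field; rewrite gt_eqF.
have H : (1 - th) * (m * (s ^+ 2 + t ^+ 2)) <= (1 - th) * (s ^+ 2 + omega * t ^+ 2).
  rewrite ler_wpM2l ?subr_ge0 ?(ltW th1)// mulrDr; apply: lerD.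
    by rewrite ler_piMl ?sqr_ge0.
  by rewrite ler_wpM2r ?sqr_ge0.
have H2 : 0 <= th * (s + o * t) ^+ 2 by rewrite mulr_ge0 ?sqr_ge0 ?ltW.
rewrite -(mulrA _ m); apply: (le_trans H); rewrite -subr_ge0.
by rewrite oE (_ : _ - _ = th * (s + o * t) ^+ 2)//; ring.
Qed.

Section Reflection.
Variable R : realType.

Lemma is_derive_reflect (f f' : R -> R) : (forall t : R, is_derive t 1 f (f' t)) ->
  forall t : R, is_derive t 1 (fun t => f (- t)) (- f' (- t)).
Proof.
move=> df t; have d1 := is_deriveNid t (1 : R).
have := @is_derive1_comp R f (fun t => - t) t (f' (- t)) (-1) (df (- t)) d1.
by rewrite mulrN1.
Qed.

Variables (a b M A : R) (f0 f1 f2 f3 J : R -> R).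
Hypotheses (a_gt0 : 0 < a) (b_gt0 : 0 < b).
Hypothesis df0 : forall t : R, is_derive t 1 f0 (f1 t).
Hypothesis df1 : forall t : R, is_derive t 1 f1 (f2 t).
Hypothesis df2 : forall t : R, is_derive t 1 f2 (f3 t).
Hypothesis df3 : forall t : R, is_derive t 1 f3
  (f0 t ^+ 3 - 2 * (b ^+ 2 - a ^+ 2) * f2 t - (a ^+ 2 + b ^+ 2) ^+ 2 * f0 t).
Hypothesis fM : forall x, [/\ `|f0 x| <= M, `|f1 x| <= M, `|f2 x| <= M & `|f3 x| <= M].
Hypothesis dJ : forall t : R, is_derive t 1 J (f0 t ^+ 2).
Hypothesis JA : forall t, 0 <= J t <= A.

(** The equation is invariant under x |-> - x, and so are the hypotheses, with - J (- x) as the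
    primitive. *)
Lemma bounded_finite_mass_decay : exists C, forall x,
  [/\ `|f0 x| <= C * expR (- a * `|x|), `|f1 x| <= C * expR (- a * `|x|),
      `|f2 x| <= C * expR (- a * `|x|) & `|f3 x| <= C * expR (- a * `|x|)].
Proof.
have van : forall e, 0 < e -> exists X, forall x, X <= x -> f0 x ^+ 2 <= e.
  apply: (@vanishing_of_integrable _ f0 f1 J M A) => //; try by move=> t; have [] := fM t.
  by move=> t; have /andP[] := JA t.
have [C [C0 fC]] := half_line_decay a_gt0 b_gt0 df0 df1 df2 df3 fM van.
pose g0 t := f0 (- t); pose g1 t := - f1 (- t).
pose g2 t := f2 (- t); pose g3 t := - f3 (- t).
have dopp (g g' : R -> R) : (forall t : R, is_derive t 1 g (g' t)) ->
    forall t : R, is_derive t 1 (fun t => - g (- t)) (g' (- t)).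
  move=> dg t; have d := is_derive_reflect dg t.
  by apply: is_derive_eq; rewrite opprK.
have dg0 : forall t : R, is_derive t 1 g0 (g1 t) by exact: is_derive_reflect.
have dg1 : forall t : R, is_derive t 1 g1 (g2 t) by exact: dopp.
have dg2 : forall t : R, is_derive t 1 g2 (g3 t) by exact: is_derive_reflect.
have dg3 : forall t : R, is_derive t 1 g3
  (g0 t ^+ 3 - 2 * (b ^+ 2 - a ^+ 2) * g2 t - (a ^+ 2 + b ^+ 2) ^+ 2 * g0 t) by exact: (dopp _ _
      df3).
have gM x : [/\ `|g0 x| <= M, `|g1 x| <= M, `|g2 x| <= M & `|g3 x| <= M].
  by have [h0 h1 h2 h3] := fM (- x); rewrite /g0 /g1 /g2 /g3 !normrN.
have gvan : forall e, 0 < e -> exists X, forall x, X <= x -> g0 x ^+ 2 <= e.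
  apply: (@vanishing_of_integrable _ g0 g1 (fun t => - J (- t)) M 0) => //.
  - exact: (dopp _ _ dJ).
  - by move=> t; have [] := gM t.
  - by move=> t; have [] := gM t.
  - by move=> t; rewrite oppr_le0; have /andP[] := JA (- t).
have [D [D0 gD]] := half_line_decay a_gt0 b_gt0 dg0 dg1 dg2 dg3 gM gvan.
exists (Num.sqrt (C + D)) => x.
suff key (f g : R -> R) : (f x ^+ 2 <= C * expR (- (2 * a) * x)) ->
    (f x ^+ 2 <= D * expR (- (2 * a) * - x)) -> `|f x| <= Num.sqrt (C + D) * expR (- a * `|x|).
  have [c0 c1 c2 c3] := fC x; have := gD (- x).
  rewrite /g0 /g1 /g2 /g3 opprK !sqrrN => -[d0 d1 d2 d3].
  by split; [apply: (key f0)|apply: (key f1)|apply: (key f2)|apply: (key f3)].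
move=> fc fd.
have e0 := expR_ge0 (- a * `|x|).
rewrite -(@ler_pXn2r _ 2)// ?nnegrE ?mulr_ge0 ?sqrtr_ge0// real_normK ?num_real//.
rewrite exprMn sqr_sqrtr ?addr_ge0// -expRM_natl.
rewrite (_ : 2%:R * (- a * `|x|) = - (2 * a) * `|x|); last by ring.
rewrite mulrDl; have [x0|x0] := leP 0 x.
  by apply: (le_trans fc); rewrite (ger0_norm x0) lerDl mulr_ge0 ?expR_ge0.
by apply: (le_trans fd); rewrite (ltr0_norm x0) lerDr mulr_ge0 ?expR_ge0.
Qed.
End Reflection.

Section GeneratedAlgebra.
Variables (R : realType) (f0 f1 f2 f3 : R -> R).

(** The algebra without unit generated by f0, ..., f3.  Constants are left out so that every
    member decays. *)
Inductive generated : (R -> R) -> Prop :=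
| generated0 : generated f0
| generated1 : generated f1
| generated2 : generated f2
| generated3 : generated f3
| generatedD f g : generated f -> generated g -> generated (f \+ g)
| generatedZ (k : R) f : generated f -> generated (fun x => k * f x)
| generatedM f g : generated f -> generated g -> generated (f \* g).

(** It suffices that f4, the derivative of the last generator, is itself generated. *)
Lemma generated_derive (f4 : R -> R) : generated f4 ->
  (forall t : R, is_derive t 1 f0 (f1 t)) -> (forall t : R, is_derive t 1 f1 (f2 t)) ->
  (forall t : R, is_derive t 1 f2 (f3 t)) -> (forall t : R, is_derive t 1 f3 (f4 t)) ->
  forall f, generated f -> exists g, generated g /\ forall t : R, is_derive t 1 f (g t).
Proof.
move=> g4 d0 d1 d2 d3 f; elim=> [||||{}f g Af [f' [Af' df]] Ag [g' [Ag' dg]]|k {}f _ [f' [Af' df]]|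
  {}f g Af [f' [Af' df]] Ag [g' [Ag' dg]]].
- by exists f1; split; [exact: generated1|].
- by exists f2; split; [exact: generated2|].
- by exists f3; split; [exact: generated3|].
- by exists f4.
- exists (f' \+ g'); split; first exact: generatedD.
  by move=> t; have e1 := df t; have e2 := dg t; apply: is_derive_eq.
- exists (fun x => k * f' x); split; first exact: generatedZ.
  by move=> t; have e1 := df t; apply: is_derive_eq.
- exists ((f \* g') \+ (g \* f')); split.
    by apply: generatedD; exact: generatedM.
  by move=> t; have e1 := df t; have e2 := dg t; apply: is_derive_eq.
Qed.

Lemma generated_decay (a C : R) : 0 < a -> (forall x,
    [/\ `|f0 x| <= C * expR (- a * `|x|), `|f1 x| <= C * expR (- a * `|x|),
      `|f2 x| <= C * expR (- a * `|x|) & `|f3 x| <= C * expR (- a * `|x|)]) ->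
  forall f, generated f -> exists C, forall x, `|f x| <= C * expR (- a * `|x|).
Proof.
move=> a0 fC f; elim=> [||||{}f g _ [D fD] _ [E gE]|k {}f _ [D fD]|{}f g _ [D fD] _ [E gE]].
- by exists C => x; have [] := fC x.
- by exists C => x; have [] := fC x.
- by exists C => x; have [] := fC x.
- by exists C => x; have [] := fC x.
- exists (D + E) => x; rewrite mulrDl; apply: (le_trans (ler_normD _ _)); exact: lerD.
- by exists (`|k| * D) => x; rewrite normrM -mulrA ler_wpM2l.
exists (D * E) => x; rewrite normrM mulrAC.
have e0 := expR_ge0 (- a * `|x|).
apply: (@le_trans _ _ ((D * expR (- a * `|x|)) * (E * expR (- a * `|x|)))).
  exact: ler_pM.
rewrite [leLHS](_ : _ = D * expR (- a * `|x|) * E * expR (- a * `|x|)); last by ring.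
have D0 : 0 <= D * expR (- a * `|x|) by apply: le_trans (fD x).
have E0 : 0 <= E.
  by have := le_trans (normr_ge0 _) (gE x); rewrite pmulr_lge0 ?expR_gt0.
by rewrite ler_piMr ?(mulr_ge0 D0 E0)// expR_le1 mulNr oppr_le0 mulr_ge0// ltW.
Qed.
End GeneratedAlgebra.

Theorem theorem5 (R : realType) (omega mu : R)
    (omega_gt0 : 0 < omega) (mu_gt0 : 0 < mu)
    (mu_lt : mu < 2 * Num.sqrt omega) :
  exists phi : R -> R,
    [/\ classical_solution omega mu phi,
        exists x, phi x <> 0,
        Sobolev_infty phi
      & exists C : R, forall x : R,
          `|phi x| <=
            C * expR (- (Num.sqrt (2 * Num.sqrt omega - mu) / 2 * `|x|))].
Proof.
have [c [c_gt0 coe]] := coercive_symbol omega_gt0 mu_gt0 mu_lt.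
have [f0 [f1 [f2 [f3 [f4 [J [M [A [df feq fM f00 dJ]]]]]]]]] := bounded_profile_exists c_gt0 coe.
pose a := Num.sqrt (2 * Num.sqrt omega - mu) / 2.
pose b := Num.sqrt (2 * Num.sqrt omega + mu) / 2.
have so : 0 < Num.sqrt omega by rewrite sqrtr_gt0.
have a_gt0 : 0 < a by rewrite divr_gt0// sqrtr_gt0 subr_gt0.
have b_gt0 : 0 < b by rewrite divr_gt0// sqrtr_gt0 addr_gt0// mulr_gt0.
have a2 : a ^+ 2 = (2 * Num.sqrt omega - mu) / 4.
  by rewrite /a exprMn sqr_sqrtr ?subr_ge0 ?(ltW mu_lt)//; field.
have b2 : b ^+ 2 = (2 * Num.sqrt omega + mu) / 4.
  by rewrite /b exprMn sqr_sqrtr ?addr_ge0 ?mulr_ge0 ?(ltW mu_gt0) ?(ltW so)//; field.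
have muE : mu = 2 * (b ^+ 2 - a ^+ 2) by rewrite a2 b2; field.
have omegaE : omega = (a ^+ 2 + b ^+ 2) ^+ 2.
  rewrite (_ : a ^+ 2 + b ^+ 2 = Num.sqrt omega) ?sqr_sqrtr// ?ltW//.
  by rewrite a2 b2; field.
have f4E t : f4 t = f0 t ^+ 3 - mu * f2 t - omega * f0 t by rewrite -feq; ring.
have d0 (t : R) : is_derive t 1 f0 (f1 t) by have [] := df t.
have d1 (t : R) : is_derive t 1 f1 (f2 t) by have [] := df t.
have d2 (t : R) : is_derive t 1 f2 (f3 t) by have [] := df t.
have d3 (t : R) : is_derive t 1 f3 (f4 t) by have [] := df t.
have [C fC] : exists C, forall x,
    [/\ `|f0 x| <= C * expR (- a * `|x|), `|f1 x| <= C * expR (- a * `|x|),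
      `|f2 x| <= C * expR (- a * `|x|) & `|f3 x| <= C * expR (- a * `|x|)].
  apply: (bounded_finite_mass_decay a_gt0 b_gt0 d0 d1 d2 _ fM (fun t => (dJ t).1)
    (fun t => (dJ t).2)).
  by move=> t; rewrite -muE -omegaE -f4E.
pose cls := generated f0 f1 f2 f3.
have cls4 : cls f4.
  have -> : f4 = (f0 \* (f0 \* f0)) \+ (fun x => (- mu) * f2 x) \+ (fun x => (- omega) * f0 x).
    by apply/funext => t; rewrite f4E /=; ring.
  apply: generatedD; last exact/generatedZ/generated0.
  apply: generatedD; last exact/generatedZ/generated2.
  by apply: generatedM; [|apply: generatedM]; exact: generated0.
have cls_derive := generated_derive cls4 d0 d1 d2 d3.
have derivE (f g : R -> R) : (forall t : R, is_derive t 1 f (g t)) -> derive1 f = g.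
  by move=> fg; apply/funext => t; rewrite derive1E; exact: (@derive_val _ _ _ _ _ _ _ (fg t)).
have cls_derivable f : cls f -> forall t : R, derivable f t 1.
  by move=> /cls_derive[g [_ dg]] t; exact: (@ex_derive _ _ _ _ _ _ _ (dg t)).
have cls_derive1 f : cls f -> cls (derive1 f).
  by move=> /cls_derive[g [Ag /derivE ->]].
have cls_decay := generated_decay a_gt0 fC.
exists f0; split.
- split; first exact: (decay_class_Ck cls_derivable cls_derive1 _ (generated0 _ _ _ _)).
  have D1 := derivE _ _ d0; have D2 := derivE _ _ d1.
  have D3 := derivE _ _ d2; have D4 := derivE _ _ d3.
  by move=> x; rewrite /derive1n /= D1 D2 D3 D4 feq subrr.
- by exists 0.
- exact: (decay_class_Sobolev a_gt0 cls_derivable cls_derive1 cls_decay (generated0 _ _ _ _)).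
- by exists C => x; have [+ _ _ _] := fC x; rewrite mulNr.
Qed.
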